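(* Let $A$ be a simple unital $C^*$-algebra, and suppose that the order on projections in $A$ is determined by traces. Let $G$ be a second-countable compact group, and let $\alpha\colon G\to\mathrm{Aut}(A)$ be an action with the Rokhlin property. Then the order on projections in $A^\alpha$ is determined by traces.
   Context: For a simple unital $C^*$-algebra $A$, let $T(A)$ be the set of tracial states on $A$; each $\tau\in T(A)$ is extended to its (unnormalized) amplification on matrix algebras over $A$, and $M_\infty(A)=\bigcup_n M_n(A)$. The order on projections in $A$ is determined by traces if whenever $p,q$ are projections in $M_\infty(A)$ with $\tau(p)\leq\tau(q)$ for all $\tau\in T(A)$, then $p$ is Murray-von Neumann subequivalent to $q$. Conventions: homomorphisms between $C^*$-algebras are $*$-homomorphisms, subalgebras are $C^*$-subalgebras; actions on $C^*$-algebras are point-norm continuous; $A^\alpha$ is the fixed point algebra. Sequence algebras: for a $C^*$-algebra $A$, let $\ell^\infty(\mathbb{N},A)$ be the $C^*$-algebra of bounded sequences in $A$, $c_0(\mathbb{N},A)$ the ideal of norm-null sequences, $A_\infty=\ell^\infty(\mathbb{N},A)/c_0(\mathbb{N},A)$ with quotient map $\eta_A$; $A$ sits in $A_\infty$ as constant sequences. For a subalgebra $D\subseteq A$, let $\mathrm{Ann}(D,A_\infty)$ be the annihilator of $D$ in $A_\infty$, an ideal of $A_\infty\cap D'$, let $F(D,A)=(A_\infty\cap D')/\mathrm{Ann}(D,A_\infty)$ and let $\kappa_{D,A}$ be the quotient map. If $\alpha\colon G\to\mathrm{Aut}(A)$ is an action and $D$ is $\alpha$-invariant, entrywise application of $\alpha$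 gives actions (not necessarily continuous) $\alpha^\infty$ on $\ell^\infty(\mathbb{N},A)$, $\alpha_\infty$ on $A_\infty$ and on $A_\infty\cap D'$, and $F(\alpha)$ on $F(D,A)$. Let $\ell^\infty_\alpha(\mathbb{N},A)$ be the set of $a\in\ell^\infty(\mathbb{N},A)$ with $g\mapsto\alpha^\infty_g(a)$ norm continuous, $A_{\infty,\alpha}=\eta_A(\ell^\infty_\alpha(\mathbb{N},A))$ and $F_\alpha(D,A)=\kappa_{D,A}(A_{\infty,\alpha}\cap D')$. Rokhlin property: an action $\alpha\colon G\to\mathrm{Aut}(A)$ of a second-countable compact group $G$ on a $\sigma$-unital $C^*$-algebra $A$ has the Rokhlin property if for every separable $\alpha$-invariant subalgebra $D\subseteq A$ there is an equivariant unital homomorphism $\varphi\colon(C(G),\mathtt{Lt})\to(F_\alpha(D,A),F(\alpha))$, where $\mathtt{Lt}$ is the action of $G$ on $C(G)$ induced by left translation. *)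

(* Defs.v *)
From HB Require Import structures.
From mathcomp Require Import all_boot all_order all_algebra complex.
From mathcomp Require Import all_classical all_reals all_analysis.

Set Implicit Arguments.
Unset Strict Implicit.
Unset Printing Implicit Defensive.

Import Order.TTheory GRing.Theory Num.Theory.
Import numFieldNormedType.Exports.

Local Open Scope classical_set_scope.
Local Open Scope ring_scope.
Local Open Scope complex_scope.
Local Open Scope quotient_scope.

(* Unital complex *-algebras.  The zero algebra is allowed, since quotients such
   as F(D, A) may vanish; this excludes the library's algType, so the complex
   algebra structure is given by its structure map k |-> k 1. *)
HB.mixin Record isStarAlgebra (R : rcfType) A of GRing.PzRing A := {
  cscal : R[i] -> A;
  cscalD : {morph cscal : k l / k + l};
  cscal1 : cscal 1 = 1;
  cscalM : {morph cscal : k l / k * l};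
  cscalC : forall (k : R[i]) (x : A), cscal k * x = x * cscal k;
  star : A -> A;
  starK : involutive star;
  starD : {morph star : x y / x + y};
  starM : forall x y : A, star (x * y) = star y * star x;
  star_cscal : forall k : R[i], star (cscal k) = cscal k^*
}.

#[short(type="starAlgType")]
HB.structure Definition StarAlgebra (R : rcfType) :=
  {A of isStarAlgebra R A & GRing.PzRing A}.

Arguments cscal {R s}.
Arguments star {R s}.

(* Nonzero unital C*-algebras.  A structure inheriting from both the rings and
   the normed modules cannot be declared on top of the library (it would have to
   precede numDomainType), so the multiplicative structure is a record over a
   complete normed module, and the carrier then receives both kinds of
   canonical instances. *)
Record cstarAlg (R : realType) := CStarAlg {
  cstar_mod : completeNormedModType R[i];
  cstar_one : cstar_mod;
  cstar_mul : cstar_mod -> cstar_mod -> cstar_mod;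
  cstar_star : cstar_mod -> cstar_mod;
  cstar_one_neq0 : cstar_one != 0;
  cstar_mulA : associative cstar_mul;
  cstar_mul1l : left_id cstar_one cstar_mul;
  cstar_mul1r : right_id cstar_one cstar_mul;
  cstar_mulDl : left_distributive cstar_mul +%R;
  cstar_mulDr : right_distributive cstar_mul +%R;
  cstar_scaleAl : forall (k : R[i]) x y,
    k *: cstar_mul x y = cstar_mul (k *: x) y;
  cstar_scaleAr : forall (k : R[i]) x y,
    k *: cstar_mul x y = cstar_mul x (k *: y);
  cstar_starK : involutive cstar_star;
  cstar_starD : {morph cstar_star : x y / x + y};
  cstar_starZ : forall (k : R[i]) x, cstar_star (k *: x) = k^* *: cstar_star x;
  cstar_starM : forall x y,
    cstar_star (cstar_mul x y) = cstar_mul (cstar_star y) (cstar_star x);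
  cstar_normM : forall x y, `|cstar_mul x y| <= `|x| * `|y|;
  cstar_normE : forall x, `|cstar_mul (cstar_star x) x| = `|x| ^+ 2
}.

Definition cstar_sort (R : realType) (A : cstarAlg R) : Type := cstar_mod A.
Coercion cstar_sort : cstarAlg >-> Sortclass.

Section CStarInstances.
Variables (R : realType) (A : cstarAlg R).

HB.instance Definition _ :=
  CompleteNormedModule.copy (cstar_sort A) (cstar_mod A).

HB.instance Definition _ := GRing.Zmodule_isNzRing.Build (cstar_sort A)
  (@cstar_mulA R A) (@cstar_mul1l R A) (@cstar_mul1r R A)
  (@cstar_mulDl R A) (@cstar_mulDr R A) (cstar_one_neq0 A).

HB.instance Definition _ :=
  GRing.Lmodule_isLalgebra.Build R[i] (cstar_sort A) (@cstar_scaleAl R A).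

HB.instance Definition _ :=
  GRing.Lalgebra_isAlgebra.Build R[i] (cstar_sort A) (@cstar_scaleAr R A).

Let cscal0 (k : R[i]) : A := k%:A.

Let star1 : cstar_star (1 : A) = (1 : A).
Proof.
rewrite -[LHS](@cstar_mul1r R A); rewrite -[X in cstar_mul _ X](@cstar_starK R A).
by rewrite -cstar_starM cstar_mul1r cstar_starK.
Qed.

Let cscal0D : {morph cscal0 : k l / k + l}.
Proof. by move=> k l; rewrite /cscal0 scalerDl. Qed.

Let cscal01 : cscal0 1 = 1.
Proof. exact: scale1r. Qed.

Let cscal0M : {morph cscal0 : k l / k * l}.
Proof. by move=> k l; rewrite /cscal0 -scalerAl mul1r scalerA. Qed.

Let cscal0C (k : R[i]) (x : A) : cscal0 k * x = x * cscal0 k.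
Proof. by rewrite /cscal0 -scalerAl -scalerAr mul1r mulr1. Qed.

Let star_cscal0 (k : R[i]) : cstar_star (cscal0 k) = cscal0 k^*.
Proof. by rewrite /cscal0 cstar_starZ star1. Qed.

HB.instance Definition _ := isStarAlgebra.Build R (cstar_sort A)
  cscal0D cscal01 cscal0M cscal0C
  (@cstar_starK R A) (@cstar_starD R A) (@cstar_starM R A) star_cscal0.

End CStarInstances.

Section StarAlgebraTheory.
Variables (R : rcfType) (B : starAlgType R).

Lemma star1 : star 1 = 1 :> B.
Proof. by rewrite -cscal1 star_cscal rmorph1. Qed.

Lemma star0 : star 0 = 0 :> B.
Proof. by apply: (addrI (star 0)); rewrite -starD !addr0. Qed.

Lemma starN : {morph star : x / - x >-> - x :> B}.
Proof. by move=> x; apply: (addrI (star x)); rewrite -starD !subrr star0. Qed.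

Lemma cscal0 : cscal 0 = 0 :> B.
Proof. by apply: (addrI (cscal 0)); rewrite -cscalD !addr0. Qed.

Lemma cscalN1 (x : B) : cscal (-1) * x = - x.
Proof.
by apply: (addrI x); rewrite subrr -{1}[x]mul1r -cscal1 -mulrDl -cscalD subrr
  cscal0 mul0r.
Qed.

End StarAlgebraTheory.

Section ComplexStarAlgebra.
Variable R : rcfType.

Let idC (k x : R[i]) : k * x = x * k. Proof. exact: mulrC. Qed.
Let conjM (x y : R[i]) : (x * y)^* = y^* * x^*.
Proof. by rewrite rmorphM mulrC. Qed.

HB.instance Definition _ := isStarAlgebra.Build R R[i]
  (fun _ _ => erefl) erefl (fun _ _ => erefl) idC
  (@conjcK R) (rmorphD conjc) conjM (fun _ => erefl).

End ComplexStarAlgebra.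

Section FunctionStarAlgebra.
Variables (R : rcfType) (T : Type) (B : starAlgType R).

Let fscal (k : R[i]) : T -> B := cst (cscal k).
Let fstar (f : T -> B) : T -> B := fun x => star (f x).

Let fscalD : {morph fscal : k l / k + l}.
Proof. by move=> k l; apply/funext => x; exact: cscalD. Qed.
Let fscal1 : fscal 1 = 1.
Proof. by apply/funext => x; exact: cscal1. Qed.
Let fscalM : {morph fscal : k l / k * l}.
Proof. by move=> k l; apply/funext => x; exact: cscalM. Qed.
Let fscalC k (f : T -> B) : fscal k * f = f * fscal k.
Proof. by apply/funext => x; exact: cscalC. Qed.
Let fstarK : involutive fstar.
Proof. by move=> f; apply/funext => x; exact: starK. Qed.
Let fstarD : {morph fstar : f g / f + g}.
Proof. by move=> f g; apply/funext => x; exact: starD. Qed.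
Let fstarM (f g : T -> B) : fstar (f * g) = fstar g * fstar f.
Proof. by apply/funext => x; exact: starM. Qed.
Let fstar_scal k : fstar (fscal k) = fscal k^*.
Proof. by apply/funext => x; exact: star_cscal. Qed.

HB.instance Definition _ := isStarAlgebra.Build R (T -> B)
  fscalD fscal1 fscalM fscalC fstarK fstarD fstarM fstar_scal.

End FunctionStarAlgebra.

(* Unital *-subalgebras, and the associated *-algebra type [sub_alg S]. *)
Record subStarAlg (R : rcfType) (B : starAlgType R) := SubStarAlg {
  sub_set :> set B;
  sub_cscal : forall k, sub_set (cscal k);
  subD : forall x y, sub_set x -> sub_set y -> sub_set (x + y);
  subM : forall x y, sub_set x -> sub_set y -> sub_set (x * y);
  sub_star : forall x, sub_set x -> sub_set (star x)
}.

Definition sub_mem (R : rcfType) (B : starAlgType R) (S : subStarAlg B) :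
  {pred B} := mem (sub_set S).

Section SubAlgebraType.
Variables (R : rcfType) (B : starAlgType R) (S : subStarAlg B).

Let sub_mem_subring : subring_closed (sub_mem S).
Proof.
split; rewrite /sub_mem /=.
- by rewrite inE -cscal1; exact: sub_cscal.
- move=> x y; rewrite !inE => Sx Sy; apply: subD => //.
  by rewrite -cscalN1; apply: subM => //; exact: sub_cscal.
- by move=> x y; rewrite !inE; exact: subM.
Qed.

HB.instance Definition _ :=
  GRing.isSubringClosed.Build B (sub_mem S) sub_mem_subring.

Record sub_alg : Type := SubAlg {
  sub_val :> B;
  sub_valP : sub_val \in sub_mem S
}.

HB.instance Definition _ := [isSub for sub_val].
HB.instance Definition _ := [Choice of sub_alg by <:].
HB.instance Definition _ := GRing.SubChoice_isSubPzRing.Build B (sub_mem S) sub_alg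
  sub_mem_subring.

Definition to_sub (x : B) (Sx : sub_set S x) : sub_alg := SubAlg (mem_set Sx).

Lemma sub_algP (x : sub_alg) : sub_set S x.
Proof. exact: set_mem (sub_valP x). Qed.

Let sscal k : sub_alg := to_sub (sub_cscal S k).
Let sstar (x : sub_alg) : sub_alg := to_sub (sub_star (sub_algP x)).

Let sscalD : {morph sscal : k l / k + l}.
Proof. by move=> k l; apply: val_inj; rewrite rmorphD /=; exact: cscalD. Qed.
Let sscal1 : sscal 1 = 1.
Proof. by apply: val_inj; rewrite rmorph1 /=; exact: cscal1. Qed.
Let sscalM : {morph sscal : k l / k * l}.
Proof. by move=> k l; apply: val_inj; rewrite rmorphM /=; exact: cscalM. Qed.
Let sscalC k (x : sub_alg) : sscal k * x = x * sscal k.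
Proof. by apply: val_inj; rewrite !rmorphM /=; exact: cscalC. Qed.
Let sstarK : involutive sstar.
Proof. by move=> x; apply: val_inj; exact: starK. Qed.
Let sstarD : {morph sstar : x y / x + y}.
Proof. by move=> x y; apply: val_inj; exact: starD. Qed.
Let sstarM (x y : sub_alg) : sstar (x * y) = sstar y * sstar x.
Proof. by apply: val_inj; exact: starM. Qed.
Let sstar_scal k : sstar (sscal k) = sscal k^*.
Proof. by apply: val_inj; exact: star_cscal. Qed.

HB.instance Definition _ := isStarAlgebra.Build R sub_alg
  sscalD sscal1 sscalM sscalC sstarK sstarD sstarM sstar_scal.

Lemma sub_valD : {morph sub_val : x y / x + y}. Proof. by []. Qed.
Lemma sub_valM : {morph sub_val : x y / x * y}. Proof. by []. Qed.
Lemma sub_val_star (x : sub_alg) : sub_val (star x) = star (sub_val x).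
Proof. by []. Qed.

End SubAlgebraType.

(* Two-sided *-ideals, not necessarily proper, and the quotient *-algebra. *)
Record starIdeal (R : rcfType) (B : starAlgType R) := StarIdeal {
  ideal_set :> set B;
  ideal0 : ideal_set 0;
  idealD : forall x y, ideal_set x -> ideal_set y -> ideal_set (x + y);
  idealMl : forall a x, ideal_set x -> ideal_set (a * x);
  idealMr : forall a x, ideal_set x -> ideal_set (x * a);
  ideal_star : forall x, ideal_set x -> ideal_set (star x)
}.

Definition ideal_mem (R : rcfType) (B : starAlgType R) (I : starIdeal B) :
  {pred B} := mem (ideal_set I).

Section QuotientAlgebra.
Variables (R : rcfType) (B : starAlgType R) (I : starIdeal B).

Let ideal_mem_zmod : zmod_closed (ideal_mem I).
Proof.
split; rewrite /ideal_mem /=; first by rewrite inE; exact: ideal0.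
move=> x y; rewrite !inE => Ix Iy; apply: idealD => //.
by rewrite -mulN1r; exact: idealMl.
Qed.

HB.instance Definition _ :=
  GRing.isZmodClosed.Build B (ideal_mem I) ideal_mem_zmod.

Definition quot_alg : Type := Quotient.quot (ideal_mem I).

HB.instance Definition _ := GRing.Zmodule.on quot_alg.

Definition quot_pi (x : B) : quot_alg := \pi_(Quotient.quot (ideal_mem I)) x.
Definition quot_repr (x : quot_alg) : B := repr (x : Quotient.quot (ideal_mem I)).

Lemma quot_reprK : cancel quot_repr quot_pi.
Proof. exact: reprK. Qed.

Lemma quot_piP (x y : B) : quot_pi x = quot_pi y <-> ideal_set I (x - y).
Proof.
have -> : ideal_set I (x - y) = (x - y \in ideal_mem I) :> Prop.
  by rewrite /ideal_mem /= inE.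
by rewrite Quotient.idealrBE; split=> [/eqP|/eqP].
Qed.

Lemma quot_repr_pi (x : B) : ideal_set I (quot_repr (quot_pi x) - x).
Proof. by apply/quot_piP; rewrite quot_reprK. Qed.

Lemma quot_piD : {morph quot_pi : x y / x + y}.
Proof. by move=> x y; rewrite /quot_pi !piE. Qed.

Let idealN x : ideal_set I x -> ideal_set I (- x).
Proof. by rewrite -mulN1r; exact: idealMl. Qed.

Let qmul (x y : quot_alg) : quot_alg := quot_pi (quot_repr x * quot_repr y).
Let qstar (x : quot_alg) : quot_alg := quot_pi (star (quot_repr x)).
Let qscal (k : R[i]) : quot_alg := quot_pi (cscal k).

Let pi_mul (x y : B) : quot_pi (x * y) = qmul (quot_pi x) (quot_pi y).
Proof.
apply/esym/quot_piP; set x' := quot_repr _; set y' := quot_repr _.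
have -> : x' * y' - x * y = (x' - x) * y' + x * (y' - y).
  by rewrite mulrBl mulrBr addrA subrK.
apply: idealD; first by apply: idealMr; exact: quot_repr_pi.
by apply: idealMl; exact: quot_repr_pi.
Qed.

Let pi_star (x : B) : quot_pi (star x) = qstar (quot_pi x).
Proof.
apply/esym/quot_piP; rewrite -starN -starD.
by apply: ideal_star; exact: quot_repr_pi.
Qed.

Let qP (P : quot_alg -> Prop) : (forall x, P (quot_pi x)) -> forall x, P x.
Proof. by move=> PP x; rewrite -[x]quot_reprK. Qed.

Let qmulA : associative qmul.
Proof.
by elim/qP => x; elim/qP => y; elim/qP => z; rewrite -!pi_mul mulrA.
Qed.
Let qmul1l : left_id (quot_pi 1) qmul.
Proof. by elim/qP => x; rewrite -pi_mul mul1r. Qed.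
Let qmul1r : right_id (quot_pi 1) qmul.
Proof. by elim/qP => x; rewrite -pi_mul mulr1. Qed.
Let qmulDl : left_distributive qmul +%R.
Proof.
by elim/qP => x; elim/qP => y; elim/qP => z;
  rewrite -quot_piD -!pi_mul -quot_piD mulrDl.
Qed.
Let qmulDr : right_distributive qmul +%R.
Proof.
by elim/qP => x; elim/qP => y; elim/qP => z;
  rewrite -quot_piD -!pi_mul -quot_piD mulrDr.
Qed.

HB.instance Definition _ := GRing.Zmodule_isPzRing.Build quot_alg
  qmulA qmul1l qmul1r qmulDl qmulDr.

Let qscalD : {morph qscal : k l / k + l}.
Proof. by move=> k l; rewrite /qscal cscalD quot_piD. Qed.
Let qscal1 : qscal 1 = 1.
Proof. by rewrite /qscal cscal1. Qed.
Let qscalM : {morph qscal : k l / k * l}.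
Proof. by move=> k l; rewrite /qscal cscalM pi_mul. Qed.
Let qscalC k (x : quot_alg) : qscal k * x = x * qscal k.
Proof.
elim/qP: x => x; rewrite /qscal -[LHS]/(qmul _ _) -[RHS]/(qmul _ _) -!pi_mul.
by rewrite cscalC.
Qed.
Let qstarK : involutive qstar.
Proof. by elim/qP => x; rewrite -!pi_star starK. Qed.
Let qstarD : {morph qstar : x y / x + y}.
Proof.
by elim/qP => x; elim/qP => y; rewrite -quot_piD -!pi_star -quot_piD starD.
Qed.
Let qstarM (x y : quot_alg) : qstar (x * y) = qstar y * qstar x.
Proof.
elim/qP: x => x; elim/qP: y => y.
rewrite -[LHS]/(qstar (qmul (quot_pi x) (quot_pi y))) -pi_mul -pi_star starM.
by rewrite pi_mul !pi_star.
Qed.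
Let qstar_scal k : qstar (qscal k) = qscal k^*.
Proof. by rewrite /qscal -pi_star star_cscal. Qed.

HB.instance Definition _ := isStarAlgebra.Build R quot_alg
  qscalD qscal1 qscalM qscalC qstarK qstarD qstarM qstar_scal.

Lemma quot_pi1 : quot_pi 1 = 1.
Proof. by []. Qed.

Lemma quot_piM : {morph quot_pi : x y / x * y}.
Proof. exact: pi_mul. Qed.

Lemma quot_pi_star (x : B) : quot_pi (star x) = star (quot_pi x).
Proof. exact: pi_star. Qed.

Lemma quot_pi_cscal (k : R[i]) : quot_pi (cscal k) = cscal k.
Proof. by []. Qed.

End QuotientAlgebra.

Record is_unital_starhom (R : rcfType) (B1 B2 : starAlgType R)
    (phi : B1 -> B2) : Prop := UnitalStarHom {
  starhomD : {morph phi : x y / x + y};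
  starhomM : {morph phi : x y / x * y};
  starhom1 : phi 1 = 1;
  starhomZ : forall (k : R[i]) x, phi (cscal k * x) = cscal k * phi x;
  starhom_star : {morph phi : x / star x}
}.

Section Traces.
Variables (R : rcfType) (B : starAlgType R).

Record tracial_state (tau : B -> R[i]) : Prop := TracialState {
  traceD : {morph tau : x y / x + y};
  traceZ : forall (k : R[i]) x, tau (cscal k * x) = k * tau x;
  trace_ge0 : forall x, 0 <= tau (star x * x);
  trace1 : tau 1 = 1;
  traceC : forall x y, tau (x * y) = tau (y * x)
}.

Definition trace_mx (tau : B -> R[i]) n (M : 'M[B]_n) : R[i] :=
  \sum_i tau (M i i).

Definition star_mx m n (M : 'M[B]_(m, n)) : 'M[B]_(n, m) :=
  \matrix_(i, j) star (M j i).

Definition is_projection n (p : 'M[B]_n) : Prop :=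
  p *m p = p /\ star_mx p = p.

Definition subprojection n (e q : 'M[B]_n) : Prop :=
  is_projection e /\ q *m e = e.

(* Projections in the union of the M_n(B) may have different sizes, and the
   implementing partial isometry is then rectangular. *)
Definition mvn_equiv m n (p : 'M[B]_m) (e : 'M[B]_n) : Prop :=
  exists v : 'M[B]_(n, m), star_mx v *m v = p /\ v *m star_mx v = e.

Definition mvn_subequiv m n (p : 'M[B]_m) (q : 'M[B]_n) : Prop :=
  exists2 e : 'M[B]_n, subprojection e q & mvn_equiv p e.

Definition order_determined_by_traces : Prop :=
  forall m n (p : 'M[B]_m) (q : 'M[B]_n),
    is_projection p -> is_projection q ->
    (forall tau, tracial_state tau -> trace_mx tau p <= trace_mx tau q) ->
    mvn_subequiv p q.

End Traces.

HB.mixin Record isTopologicalGroup G of Group G & Topological G := {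
  mulg_continuous : continuous (fun xy : G * G => (xy.1 * xy.2)%g);
  invg_continuous : continuous (fun x : G => (x^-1)%g)
}.

#[short(type="topGroupType")]
HB.structure Definition TopologicalGroup :=
  {G of isTopologicalGroup G & Group G & Topological G}.

Section ContinuousFunctions.
Variables (R : realType) (G : topGroupType).

Let CG : set (G -> R[i]) := [set f | continuous (f : G -> R[i]^o)].

Let CG_cscal k : CG (cscal k).
Proof. by move=> x; exact: cvg_cst. Qed.
Let CG_D f g : CG f -> CG g -> CG (f + g).
Proof. by move=> cf cg x; apply: (@cvgD _ R[i]^o); [exact: cf|exact: cg]. Qed.
Let CG_M f g : CG f -> CG g -> CG (f * g).
Proof. by move=> cf cg x; apply: (@cvgM R[i]); [exact: cf|exact: cg]. Qed.
Let CG_star f : CG f -> CG (star f).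
Proof.
move=> cf x; apply/(@cvgrPdist_lt _ R[i]^o) => e e0.
have /(@cvgrPdist_lt _ R[i]^o) /(_ e e0) := cf x.
apply: filterS => y; rewrite -[star f x]/((f x)^*) -[star f y]/((f y)^*).
by rewrite -rmorphB /= normcJ.
Qed.

Definition cont_fun : subStarAlg (G -> R[i]) :=
  SubStarAlg CG_cscal CG_D CG_M CG_star.

Let translate_subproof (g : G) (f : sub_alg cont_fun) :
  sub_set cont_fun (fun h => sub_val f (g^-1 * h)%g).
Proof.
move=> h /=.
apply: (@continuous_comp _ _ _ (fun h : G => (g^-1 * h)%g)
  (sub_val f : G -> R[i]^o)); last exact: (sub_algP f).
apply: (@continuous_comp _ _ _ (fun h : G => (g^-1%g, h))
  (fun xy : G * G => (xy.1 * xy.2)%g)); last exact: mulg_continuous.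
by apply: cvg_pair => //=; exact: cvg_cst.
Qed.

Definition Lt (g : G) (f : sub_alg cont_fun) : sub_alg cont_fun :=
  to_sub (@translate_subproof g f).

End ContinuousFunctions.

Arguments cont_fun : clear implicits.

Section SequenceAlgebra.
Variables (R : realType) (A : cstarAlg R).

Lemma normM_le (x y : A) : `|x * y| <= `|x| * `|y|.
Proof. exact: cstar_normM. Qed.

Lemma norm_starM (x : A) : `|star x * x| = `|x| ^+ 2.
Proof. exact: cstar_normE. Qed.

Lemma norm_star (x : A) : `|star x| = `|x|.
Proof.
suff le (y : A) : `|y| <= `|star y|.
  by apply/le_anti; rewrite le /= -{2}[x]starK le.
have [->|y0] := eqVneq y 0; first by rewrite normr0.
rewrite -(@ler_pM2r _ `|y|) ?normr_gt0 // -expr2 -norm_starM.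
exact: normM_le.
Qed.

Let ell : set (nat -> A) := [set a | exists M : R[i], forall n, `|a n| <= M].

Let ell_cscal k : ell (cscal k).
Proof. by exists `|cscal k : A|. Qed.
Let ell_D a b : ell a -> ell b -> ell (a + b).
Proof.
move=> [M aM] [N bN]; exists (M + N) => n.
by rewrite (le_trans (ler_normD _ _)) // lerD.
Qed.
Let ell_M a b : ell a -> ell b -> ell (a * b).
Proof.
move=> [M aM] [N bN]; exists (M * N) => n.
apply: (le_trans (normM_le (a n) (b n))).
by apply: ler_pM => //; exact: normr_ge0.
Qed.
Let ell_star a : ell a -> ell (star a).
Proof. by move=> [M aM]; exists M => n; rewrite norm_star. Qed.

Definition linfty : subStarAlg (nat -> A) :=
  SubStarAlg ell_cscal ell_D ell_M ell_star.

Let cz : set (sub_alg linfty) := [set a | sub_val a n @[n --> \oo] --> (0 : A)].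

Let czE a : cz a <->
  forall e : R[i], 0 < e -> \forall n \near \oo, `|sub_val a n : A| < e.
Proof. by split=> [/cvgr0Pnorm_lt|h]; [|exact/cvgr0Pnorm_lt]. Qed.

Let cz0 : cz 0.
Proof. exact: cvg_cst. Qed.
Let cz_D a b : cz a -> cz b -> cz (a + b).
Proof. by move=> ca cb; rewrite /cz /= -[0]addr0; exact: cvgD. Qed.
Let cz_bound (a b : sub_alg linfty) (M : R[i]) : 0 < M -> cz a ->
  (forall n, `|sub_val b n : A| <= M * `|sub_val a n : A|) -> cz b.
Proof.
move=> M0 /czE ca ab; apply/czE => e e0.
apply: filterS (ca (e / M) (divr_gt0 e0 M0)) => n an.
by rewrite (le_lt_trans (ab n)) // mulrC -ltr_pdivlMr.
Qed.
Let boundP (a : sub_alg linfty) :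
  exists2 M : R[i], 0 < M & forall n, `|sub_val a n : A| <= M.
Proof.
have [M aM] := sub_algP a; exists (M + 1).
  by rewrite ltr_wpDl // (le_trans _ (aM 0%N)).
by move=> n; rewrite (le_trans (aM n)) // lerDl.
Qed.
Let cz_Ml a b : cz b -> cz (a * b).
Proof.
have [M M0 aM] := boundP a; move=> cb; apply: (cz_bound M0 cb) => n.
rewrite sub_valM mulrfctE.
apply: (le_trans (normM_le _ _)).
by apply: ler_wpM2r (aM n); exact: normr_ge0.
Qed.
Let cz_Mr a b : cz b -> cz (b * a).
Proof.
have [M M0 aM] := boundP a; move=> cb; apply: (cz_bound M0 cb) => n.
rewrite sub_valM mulrfctE.
apply: (le_trans (normM_le _ _)).
by rewrite mulrC; apply: ler_wpM2r (aM n); exact: normr_ge0.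
Qed.
Let cz_star a : cz a -> cz (star a).
Proof.
by move=> ca; apply: (cz_bound ltr01 ca) => n; rewrite mul1r norm_star.
Qed.

Definition c0 : starIdeal (sub_alg linfty) :=
  StarIdeal cz0 cz_D cz_Ml cz_Mr cz_star.

Definition Ainfty : Type := quot_alg c0.
HB.instance Definition _ := StarAlgebra.on Ainfty.

Definition eta : sub_alg linfty -> Ainfty := @quot_pi R _ c0.
Definition eta_repr : Ainfty -> sub_alg linfty := @quot_repr R _ c0.

Let const_subproof (d : A) : sub_set linfty (fun=> d).
Proof. by exists `|d|. Qed.

Definition const_Ainfty (d : A) : Ainfty := eta (to_sub (const_subproof d)).

Lemma const_Ainfty_star (d : A) : const_Ainfty (star d) = star (const_Ainfty d).
Proof. by rewrite /const_Ainfty -quot_pi_star; congr (eta _); exact: val_inj. Qed.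

End SequenceAlgebra.

Arguments Ainfty {R} A.
Arguments const_Ainfty {R A}.

(* C*-subalgebras, not necessarily unital. *)
Record cstarSubAlg (R : realType) (A : cstarAlg R) := CStarSubAlg {
  csub_set :> set A;
  csub0 : csub_set 0;
  csubD : forall x y, csub_set x -> csub_set y -> csub_set (x + y);
  csubZ : forall (k : R[i]) x, csub_set x -> csub_set (k *: x);
  csubM : forall x y, csub_set x -> csub_set y -> csub_set (x * y);
  csub_star : forall x, csub_set x -> csub_set (star x);
  csub_closed : closed csub_set
}.

Section CentralSequences.
Variables (R : realType) (A : cstarAlg R) (D : cstarSubAlg A).

Let com : set (Ainfty A) :=
  [set x | forall d, csub_set D d -> x * const_Ainfty d = const_Ainfty d * x].

Let com_cscal k : com (cscal k).
Proof. by move=> d _; exact: cscalC. Qed.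
Let com_D x y : com x -> com y -> com (x + y).
Proof. by move=> cx cy d Dd; rewrite mulrDl mulrDr cx // cy. Qed.
Let com_M x y : com x -> com y -> com (x * y).
Proof. by move=> cx cy d Dd; rewrite -mulrA cy // !mulrA cx. Qed.
Let com_star x : com x -> com (star x).
Proof.
move=> cx d Dd; rewrite -{1}[d]starK -{2}[d]starK !(const_Ainfty_star (star d)).
by rewrite -!starM cx //; exact: csub_star.
Qed.

Definition commutant : subStarAlg (Ainfty A) :=
  SubStarAlg com_cscal com_D com_M com_star.

Let ann : set (sub_alg commutant) := [set x | forall d, csub_set D d ->
  sub_val x * const_Ainfty d = 0 /\ const_Ainfty d * sub_val x = 0].

Let ann0 : ann 0.
Proof. by move=> d _ /=; rewrite mul0r mulr0. Qed.
Let ann_D x y : ann x -> ann y -> ann (x + y).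
Proof.
move=> ax ay d Dd; have [xd dx] := ax d Dd; have [yd dy] := ay d Dd.
by rewrite sub_valD mulrDl mulrDr xd dx yd dy addr0.
Qed.
Let ann_Ml a x : ann x -> ann (a * x).
Proof.
move=> ax d Dd; have [xd dx] := ax d Dd; rewrite sub_valM; split.
  by rewrite -mulrA xd mulr0.
by rewrite mulrA -(sub_algP a) // -mulrA dx mulr0.
Qed.
Let ann_Mr a x : ann x -> ann (x * a).
Proof.
move=> ax d Dd; have [xd dx] := ax d Dd; rewrite sub_valM; split.
  by rewrite -mulrA (sub_algP a) // mulrA xd mul0r.
by rewrite mulrA dx mul0r.
Qed.
Let ann_star x : ann x -> ann (star x).
Proof.
move=> ax d Dd; have [xd dx] := ax _ (csub_star Dd).
rewrite -{1}[d]starK -{2}[d]starK !(const_Ainfty_star (star d)).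
rewrite sub_val_star.
by rewrite -!starM xd dx star0.
Qed.

Definition Ann : starIdeal (sub_alg commutant) :=
  StarIdeal ann0 ann_D ann_Ml ann_Mr ann_star.

Definition centralF : Type := quot_alg Ann.
HB.instance Definition _ := StarAlgebra.on centralF.

Definition kappa : sub_alg commutant -> centralF := @quot_pi R _ Ann.
Definition kappa_repr : centralF -> sub_alg commutant := @quot_repr R _ Ann.

End CentralSequences.

(* Each map alpha g is invertible, with inverse alpha g^-1, hence an automorphism. *)
Record cstarAction (R : realType) (G : topGroupType) (A : cstarAlg R) :=
    CStarAction {
  action_fun :> G -> A -> A;
  action_hom : forall g, is_unital_starhom (action_fun g);
  action1 : action_fun 1%g =1 id;
  actionM : forall g h a,
    action_fun (g * h)%g a = action_fun g (action_fun h a);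
  action_continuous : forall a : A, continuous (fun g => action_fun g a)
}.

Section Actions.
Variables (R : realType) (G : topGroupType) (A : cstarAlg R).
Variable alpha : cstarAction G A.

Let fix_ : set A := [set a | forall g, alpha g a = a].

Let fix_cscal k : fix_ (cscal k).
Proof.
move=> g; have h := action_hom alpha g.
by rewrite -[cscal k]mulr1 (starhomZ h) (starhom1 h).
Qed.
Let fix_D x y : fix_ x -> fix_ y -> fix_ (x + y).
Proof. by move=> fx fy g; rewrite (starhomD (action_hom alpha g)) fx fy. Qed.
Let fix_M x y : fix_ x -> fix_ y -> fix_ (x * y).
Proof. by move=> fx fy g; rewrite (starhomM (action_hom alpha g)) fx fy. Qed.
Let fix_star x : fix_ x -> fix_ (star x).
Proof. by move=> fx g; rewrite (starhom_star (action_hom alpha g)) fx. Qed.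

Definition fixed_alg : subStarAlg A :=
  SubStarAlg fix_cscal fix_D fix_M fix_star.

(* The induced maps below go through representatives, and [insubd] requires no
   proof that its second argument lies in the subtype.  Its default value 0 is
   never used: automorphisms of C*-algebras are isometric, so they preserve
   bounded and null sequences, and [act_F] is used for invariant D only. *)
Definition act_linfty (g : G) (a : sub_alg (linfty A)) : sub_alg (linfty A) :=
  insubd (0 : sub_alg (linfty A)) (fun n => alpha g (sub_val a n)).

Definition act_Ainfty (g : G) (x : Ainfty A) : Ainfty A :=
  eta (act_linfty g (eta_repr x)).

Definition act_F (D : cstarSubAlg A) (g : G) (x : centralF D) : centralF D :=
  kappa (insubd (0 : sub_alg (commutant D))
    (act_Ainfty g (sub_val (kappa_repr x)))).

(* On bounded sequences, uniform convergence is convergence in norm. *)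
Definition linfty_cont : set (sub_alg (linfty A)) :=
  [set a | continuous
     (fun g => sub_val (act_linfty g a) : {uniform nat -> A})].

Definition Ainfty_cont : set (Ainfty A) := @eta R A @` linfty_cont.

Definition F_cont (D : cstarSubAlg A) : set (centralF D) :=
  @kappa R A D @` [set x | Ainfty_cont (sub_val x)].

Definition invariant_sub (D : cstarSubAlg A) : Prop :=
  forall g d, csub_set D d -> csub_set D (alpha g d).

Definition separable_sub (D : cstarSubAlg A) : Prop :=
  exists E : set A, [/\ countable E, E `<=` csub_set D &
                        csub_set D `<=` closure E].

Definition Rokhlin : Prop :=
  forall D : cstarSubAlg A, separable_sub D -> invariant_sub D ->
  exists phi : sub_alg (cont_fun R G) -> centralF D,
    [/\ is_unital_starhom phi,
        forall f, F_cont (phi f) &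
        forall g f, phi (Lt g f) = act_F g (phi f)].

End Actions.

Record closed_ideal (R : realType) (A : cstarAlg R) (I : set A) : Prop :=
    ClosedIdeal {
  cideal0 : I 0;
  cidealD : forall x y, I x -> I y -> I (x + y);
  cidealMl : forall a x, I x -> I (a * x);
  cidealMr : forall a x, I x -> I (x * a);
  cideal_closed : closed I
}.

Definition simple_cstar (R : realType) (A : cstarAlg R) : Prop :=
  forall I : set A, closed_ideal I -> I = [set 0] \/ I = setT.

(* Main.v *)
Require Import Defs.
From mathcomp Require Import all_boot all_order all_algebra complex.
From mathcomp Require Import all_classical all_reals all_analysis.
From mathcomp Require Import ring lra.

(* The comparison of traces holds in A, since traces of A restrict to the fixed
   point algebra, so it gives v in M(A) with v^* v = p and q v = v. Let D be a
   separable invariant unital subalgebra containing the entries of v. With a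
   partition of unity (w_i^2) on G along which the orbit map g |-> alpha_g(v) is
   nearly constant, put W = sum_i alpha_{g_i}(v) Phi(w_i^2), where Phi : C(G) -> F(D, A)
   is the equivariant map of the Rokhlin property. Double sums over products of
   two partitions of unity show that W is almost invariant and W^* W is almost p;
   they are controlled by |sum_i Phi(w_i^2) b_i| <= 2 max |b_i|, obtained by writing
   c - T and c + T as sums of squares. A term of a lift of W is then averaged into
   the fixed point algebra, and a Newton-Schulz iteration makes it an exact partial
   isometry. *)

Set Implicit Arguments.
Unset Strict Implicit.
Unset Printing Implicit Defensive.

Import Order.TTheory GRing.Theory Num.Theory.
Import numFieldNormedType.Exports.

Local Open Scope classical_set_scope.
Local Open Scope ring_scope.
Local Open Scope complex_scope.

(** * Norms and limits *)

(** Conceptually, [Phi] and the inclusion of [D] combine to an equivariant map from C(G, D) to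
    [Ainfty A]. The orbit function h |-> alpha_h(v) is fixed by the diagonal action on C(G, D),
    because alpha_g(alpha_{g^-1 h}(v)) = alpha_h(v), so its image would be an invariant partial
    isometry. Only step functions are mapped here, so the boundedness of that map is needed just for
    finite sums; the constant 2 is the price of treating real and imaginary parts separately. The
    arguments with positivity rest on one fact: if x and s are commuting self-adjoint elements with
    x^2 + s^2 = c^2 and c >= 0, then |x| <= c. It gives the positivity of squares, the contractivity
    of unital homomorphisms and the bound on finite sums. *)

Section RealNorm.
Variables (R : realType) (A : cstarAlg R).
Implicit Types (x y z : A) (r : R).

(** The norm takes its values in [R[i]]; real values are open to [lra] and [nra]. *)
Definition nrm x : R := complex.Re `|x|.

Lemma nrmE x : `|x| = (nrm x)%:C.
Proof. by rewrite /nrm RRe_real // normr_real. Qed.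

Lemma nrm_ge0 x : 0 <= nrm x.
Proof. by rewrite -ler0c -nrmE normr_ge0. Qed.

Lemma nrmD x y : nrm (x + y) <= nrm x + nrm y.
Proof. by rewrite -lecR rmorphD /= -!nrmE ler_normD. Qed.

Lemma nrmM x y : nrm (x * y) <= nrm x * nrm y.
Proof. by rewrite -lecR rmorphM /= -!nrmE normM_le. Qed.

Lemma nrmN x : nrm (- x) = nrm x.
Proof. by rewrite /nrm normrN. Qed.

Lemma nrmBC x y : nrm (x - y) = nrm (y - x).
Proof. by rewrite /nrm distrC. Qed.

Lemma nrm0 : nrm 0 = 0.
Proof. by rewrite /nrm normr0. Qed.

Lemma nrm_eq0 x : nrm x = 0 -> x = 0.
Proof. by move=> x0; apply/eqP; rewrite -normr_eq0 nrmE x0. Qed.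

Lemma nrm_star x : nrm (star x) = nrm x.
Proof. by rewrite /nrm norm_star. Qed.

Lemma nrm_starM x : nrm (star x * x) = nrm x ^+ 2.
Proof. by apply: (@complexI R); rewrite rmorphXn /= -!nrmE norm_starM. Qed.

Lemma cscalE (k : R[i]) x : cscal k * x = k *: x.
Proof. by rewrite -[cscal k]/(k *: (1 : A)) -scalerAl mul1r. Qed.

Lemma starZ (k : R[i]) x : star (k *: x) = k^* *: star x.
Proof. by rewrite -!cscalE starM star_cscal cscalC. Qed.

Lemma conj_i : ('i%C : R[i])^*%R = - 'i%C.
Proof.
transitivity (conjc ('i%C : R[i])) => //.
by apply/eqP; rewrite eq_complex /= oppr0 !eqxx.
Qed.

Lemma nrmZc (k : R[i]) x : nrm (k *: x) = complex.Re `|k| * nrm x.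
Proof.
apply: (@complexI R); rewrite rmorphM /= -!nrmE normrZ; congr (_ * _).
Qed.

Lemma nrmZ r x : nrm (r%:C *: x) = `|r| * nrm x.
Proof. by rewrite nrmZc normc_def /= expr0n addr0 sqrtr_sqr. Qed.

Lemma nrmZi x : nrm ('i%C *: x) = nrm x.
Proof. by rewrite nrmZc normc_def /= expr0n expr1n add0r sqrtr1 mul1r. Qed.

Lemma nrm1 : nrm (1 : A) = 1.
Proof.
have n0 : nrm (1 : A) != 0.
  by apply/eqP => /nrm_eq0 /eqP; rewrite oner_eq0.
by apply: (mulfI n0); rewrite mulr1 -expr2 -nrm_starM star1 mulr1.
Qed.

Lemma nrm_real r : nrm (r%:C%:A : A) = `|r|.
Proof. by rewrite nrmZ nrm1 mulr1. Qed.

Lemma nrmB x y : nrm (x - y) <= nrm x + nrm y.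
Proof. by rewrite (le_trans (nrmD _ _)) // nrmN. Qed.

Lemma nrm_dist x y z : nrm (x - z) <= nrm (x - y) + nrm (y - z).
Proof. by rewrite (le_trans _ (nrmD _ _)) // addrA subrK. Qed.

Lemma nrm_sum (I : Type) (s : seq I) (P : pred I) (F : I -> A) :
  nrm (\sum_(i <- s | P i) F i) <= \sum_(i <- s | P i) nrm (F i).
Proof.
elim/big_ind2: _ => //; first by rewrite nrm0.
by move=> x1 x2 y1 y2 h1 h2; rewrite (le_trans (nrmD _ _)) // lerD.
Qed.

Lemma nrm_le_eps0 x : (forall e : R, 0 < e -> nrm x <= e) -> x = 0.
Proof.
move=> h; apply: nrm_eq0; apply/eqP; rewrite eq_le nrm_ge0 andbT.
by apply/ler_addgt0Pl => e e0; rewrite addr0 h.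
Qed.

Definition ncvg (u : nat -> A) (l : A) :=
  forall e : R, 0 < e -> exists N, forall n, (N <= n)%N -> nrm (u n - l) <= e.

Lemma lt0c (e : R[i]) : 0 < e -> exists2 r : R, 0 < r & e = r%:C.
Proof.
move=> e0; have er : e \is Num.real by rewrite gtr0_real.
by exists (complex.Re e); [rewrite -ltcR RRe_real|rewrite RRe_real].
Qed.

Lemma ncvgP (u : nat -> A) l : ncvg u l <-> u @ \oo --> l.
Proof.
split=> [ul|/cvgrPdist_le ul e e0].
  apply/cvgrPdist_le => _ /lt0c[e e0 ->].
  have [N uN] := ul _ e0; exists N => // n /= Nn.
  by rewrite nrmE lecR nrmBC uN.
have /ul[N _ uN] : 0 < e%:C by rewrite ltcR.
exists N => n Nn; rewrite -lecR -nrmE distrC; exact: uN.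
Qed.

Lemma ncvg_uniq (u : nat -> A) l l' : ncvg u l -> ncvg u l' -> l = l'.
Proof.
move=> ul ul'; apply/eqP; rewrite -subr_eq0; apply/eqP/nrm_le_eps0 => e e0.
have e2 : 0 < e / 2 by lra.
have [N uN] := ul _ e2; have [N' uN'] := ul' _ e2.
rewrite (le_trans (nrm_dist _ (u (maxn N N')) _)) // nrmBC.
have := uN _ (leq_maxl N N'); have := uN' _ (leq_maxr N N'); lra.
Qed.

Lemma closed_ncvg (P : set A) (u : nat -> A) l :
  closed P -> (forall n, P (u n)) -> ncvg u l -> P l.
Proof.
move=> cP Pu /ncvgP ul; apply: (closed_cvg P cP) ul.
by exists 0%N => // n _; exact: Pu.
Qed.

Lemma halfr_gt0 r : 0 < r -> 0 < r / 2.
Proof. by lra. Qed.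

Lemma ncvg_cauchy (u : nat -> A) :
  (forall e : R, 0 < e -> exists N, forall n, (N <= n)%N -> nrm (u n - u N) <= e) ->
  exists l, ncvg u l.
Proof.
move=> cu; suff /cvg_ex[l ul] : cvgn u by exists l; apply/ncvgP.
apply/cauchy_cvgP/cauchy_exP => _ /lt0c[e e0 ->].
have [N uN] := cu _ (halfr_gt0 e0); exists (u N), N => // n /= Nn.
rewrite -ball_normE /= nrmE ltcR nrmBC.
have := uN _ Nn; lra.
Qed.

Lemma ncvg_geometric (u : nat -> A) (C b : R) : 0 <= b < 1 ->
  (forall n, nrm (u n.+1 - u n) <= C * b ^+ n) ->
  exists l, ncvg u l.
Proof.
move=> /andP[b0 b1] ub; apply: ncvg_cauchy => e e0.
have b1' : 0 < 1 - b by lra.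
have C0 : 0 <= C by rewrite (le_trans (nrm_ge0 _) (le_trans (ub 0%N) _)) // expr0 mulr1.
(* A partial geometric sum starting at [N]; in this form the induction step is an identity. *)
have bound N k : nrm (u (N + k)%N - u N) <= C * b ^+ N / (1 - b) * (1 - b ^+ k).
  elim: k => [|k IH]; first by rewrite addn0 subrr nrm0 expr0 subrr mulr0.
  rewrite (le_trans (nrm_dist _ (u (N + k)%N) _)) //.
  rewrite addnS (le_trans (lerD (ub _) IH)) // exprD exprS.
  by rewrite le_eqVlt; apply/orP; left; apply/eqP; field; lra.
have /cvgrPdist_le /(_ (e * (1 - b) / (C + 1))) : (fun n => b ^+ n) @ \oo --> (0 : R).
  by apply: cvg_expr; rewrite ger0_norm.
case; first by rewrite divr_gt0 ?mulr_gt0 //; lra.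
move=> N _ /(_ N (leqnn N)); rewrite sub0r normrN ger0_norm ?exprn_ge0 // => bN.
exists N => n Nn; rewrite -(subnKC Nn) (le_trans (bound _ _)) //.
have bk : 0 <= b ^+ (n - N) by rewrite exprn_ge0.
rewrite (@le_trans _ _ (C * b ^+ N / (1 - b))) //.
  by rewrite ler_piMr ?divr_ge0 ?mulr_ge0 ?exprn_ge0 //; lra.
rewrite ler_pdivrMr //; move: bN; rewrite ler_pdivlMr; last lra.
have := exprn_ge0 N b0; nra.
Qed.

Lemma ncvgD (u v : nat -> A) x y :
  ncvg u x -> ncvg v y -> ncvg (fun n => u n + v n) (x + y).
Proof. by move=> /ncvgP ux /ncvgP vy; apply/ncvgP; exact: cvgD. Qed.

Lemma ncvg_cst x : ncvg (fun=> x) x.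
Proof. by move=> e e0; exists 0%N => n _; rewrite subrr nrm0 ltW. Qed.

Lemma ncvgS (u : nat -> A) x : ncvg u x -> ncvg (fun n => u n.+1) x.
Proof. by move=> ux e /ux[N uN]; exists N => n Nn; rewrite uN // ltnW. Qed.

Lemma ncvg_lip (f : A -> A) (C : R) (u : nat -> A) x :
  (forall n, nrm (f (u n) - f x) <= C * nrm (u n - x)) ->
  ncvg u x -> ncvg (fun n => f (u n)) (f x).
Proof.
move=> fC ux e e0; have C1 : 0 < `|C| + 1 by rewrite ltr_wpDl.
have [N uN] := ux (e / (`|C| + 1)) (divr_gt0 e0 C1).
exists N => n Nn; rewrite (le_trans (fC n)) //.
have := uN n Nn; rewrite ler_pdivlMr // => h.
have := ler_norm C; have := nrm_ge0 (u n - x); nra.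
Qed.

Lemma ncvg_star (u : nat -> A) x : ncvg u x -> ncvg (fun n => star (u n)) (star x).
Proof.
by apply: (@ncvg_lip star 1) => n; rewrite -starN -starD nrm_star mul1r.
Qed.

Lemma ncvgZ k (u : nat -> A) x : ncvg u x -> ncvg (fun n => k *: u n) (k *: x).
Proof.
by apply: (@ncvg_lip _ (complex.Re `|k|)) => n; rewrite -scalerBr nrmZc.
Qed.

Lemma ncvg_bound (u : nat -> A) x : ncvg u x ->
  exists N, forall n, (N <= n)%N -> nrm (u n) <= nrm x + 1.
Proof.
move=> /(_ 1 ltr01)[N uN]; exists N => n Nn.
rewrite -[u n](subrK x) (le_trans (nrmD _ _)) // addrC lerD2l; exact: uN.
Qed.

Lemma ncvgM (u v : nat -> A) x y :
  ncvg u x -> ncvg v y -> ncvg (fun n => u n * v n) (x * y).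
Proof.
move=> ux vy e e0; have [N uN] := ncvg_bound ux.
have Kx : 0 < nrm x + 1 by have := nrm_ge0 x; lra.
have Ky : 0 < nrm y + 1 by have := nrm_ge0 y; lra.
have [N1 uN1] := ux (e / 2 / (nrm y + 1)) (divr_gt0 (halfr_gt0 e0) Ky).
have [N2 vN2] := vy (e / 2 / (nrm x + 1)) (divr_gt0 (halfr_gt0 e0) Kx).
exists (maxn N (maxn N1 N2)) => n; rewrite !geq_max => /and3P[n0 n1 n2].
have -> : u n * v n - x * y = u n * (v n - y) + (u n - x) * y.
  by rewrite mulrBr mulrBl addrA subrK.
rewrite (le_trans (nrmD _ _)) // (le_trans (lerD (nrmM _ _) (nrmM _ _))) //.
have h1 := uN1 n n1; have h2 := vN2 n n2.
rewrite ler_pdivlMr // in h1; rewrite ler_pdivlMr // in h2.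
rewrite [leRHS]splitr lerD //.
  apply: le_trans h2; rewrite mulrC; apply: ler_wpM2l (uN n n0); exact: nrm_ge0.
apply: le_trans h1; apply: ler_wpM2l; first exact: nrm_ge0.
by rewrite lerDl.
Qed.

Lemma ncvg_nrm_le (u : nat -> A) x c : ncvg u x ->
  (forall n, nrm (u n) <= c) -> nrm x <= c.
Proof.
move=> ux uc; apply/ler_addgt0Pl => e e0; have [N uN] := ux e e0.
rewrite -[x](subKr (u N)) (le_trans (nrmB _ _)) // addrC lerD //; exact: uN.
Qed.

End RealNorm.

(** * Positivity *)

Section Positivity.
Variables (R : realType) (A : cstarAlg R).
Implicit Types (x y z s t : A).

(** [r] is the power series of 1 - sqrt(1 - z), found as a fixed point of x |-> (z + x^2) / 2, so
    that (1 - r)^2 = 1 - z. The clause on [P] carries over to [r] every sequentially closed property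
    that survives the iteration, such as self-adjointness or membership in a closed subalgebra. *)
Lemma sqrt_fixpoint z : nrm z < 1 ->
  exists r, r + r = z + r * r /\
    forall P : set A, (forall u l, (forall n, P (u n)) -> ncvg u l -> P l) ->
      P 0 -> (forall x, P x -> P ((2^-1)%:C *: (z + x * x))) -> P r.
Proof.
move=> z1; have z0 := nrm_ge0 z.
pose u := fix u n := if n is m.+1 then (2^-1)%:C *: (z + u m * u m) else 0.
have uS n : u n.+1 = (2^-1)%:C *: (z + u n * u n) by [].
have h2 : `|2^-1| = 2^-1 :> R by rewrite ger0_norm // invr_ge0.
have ub n : nrm (u n) <= nrm z.
  elim: n => [|n IH]; first by rewrite nrm0.
  rewrite uS nrmZ h2; have := nrmD z (u n * u n); have := nrmM (u n) (u n).
  have := nrm_ge0 (u n); nra.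
(* A difference of squares splits into two terms, each at most [nrm z] times the previous
   difference; the factor one half absorbs their number. *)
have du n : nrm (u n.+1 - u n) <= nrm z * nrm z ^+ n.
  elim: n => [|n IH].
    by rewrite /= mulr0 addr0 subr0 nrmZ h2 expr0 mulr1; lra.
  rewrite uS [u n.+1 in X in _ - X]uS -scalerBr nrmZ h2 opprD addrACA subrr add0r.
  have -> : u n.+1 * u n.+1 - u n * u n =
      u n.+1 * (u n.+1 - u n) + (u n.+1 - u n) * u n.
    by rewrite mulrBr mulrBl addrA subrK.
  have := nrmD (u n.+1 * (u n.+1 - u n)) ((u n.+1 - u n) * u n).
  have := nrmM (u n.+1) (u n.+1 - u n); have := nrmM (u n.+1 - u n) (u n).
  have := ub n; have := ub n.+1; have d0 := nrm_ge0 (u n.+1 - u n).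
  move=> b1 b2 m1 m2 m3.
  have c1 : nrm (u n.+1) * nrm (u n.+1 - u n) <= nrm z * nrm (u n.+1 - u n).
    by rewrite ler_wpM2r.
  have c2 : nrm (u n.+1 - u n) * nrm (u n) <= nrm z * nrm (u n.+1 - u n).
    by rewrite mulrC ler_wpM2r.
  have c3 : nrm z * nrm (u n.+1 - u n) <= nrm z * (nrm z * nrm z ^+ n).
    by rewrite ler_wpM2l.
  rewrite exprS; lra.
have [|r ur] := ncvg_geometric _ du; first by rewrite z0 z1.
exists r; split=> [|P cP P0 PS]; last first.
  by apply: cP ur; elim=> [//|n IH]; rewrite uS; exact: PS.
have := ncvg_uniq (ncvgS ur) (ncvgZ (2^-1)%:C (ncvgD (@ncvg_cst _ _ z) (ncvgM ur ur))).
have hh : 2^-1 + 2^-1 = 1 :> R by lra.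
move=> {1 2}->; by rewrite -scalerDl -rmorphD /= hh scale1r.
Qed.


(** Closure under [star] is left out so that the commutant of an arbitrary element qualifies. *)
Record closed_unital_subalg (P : set A) : Prop := ClosedUnitalSubalg {
  cus_lim : forall u l, (forall n, P (u n)) -> ncvg u l -> P l;
  cus1 : P 1;
  cusD : forall x y, P x -> P y -> P (x + y);
  cusZ : forall k x, P x -> P (k *: x);
  cusM : forall x y, P x -> P y -> P (x * y)
}.

Lemma commutant_closed_unital y : closed_unital_subalg [set x | x * y = y * x].
Proof.
split => /=.
- move=> u l uy ul; have h1 := ncvgM ul (@ncvg_cst _ _ y).
  have h2 := ncvgM (@ncvg_cst _ _ y) ul; apply: ncvg_uniq h1 _.
  by move=> e /h2[N h]; exists N => n Nn; rewrite uy; exact: h.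
- by rewrite mul1r mulr1.
- by move=> x x' h h'; rewrite mulrDl mulrDr h h'.
- by move=> k x h; rewrite -scalerAl -scalerAr h.
- by move=> x x' h h'; rewrite -mulrA h' !mulrA h.
Qed.

Lemma cusB (P : set A) x y :
  closed_unital_subalg P -> P x -> P y -> P (x - y).
Proof.
by move=> cP Px Py; apply: cusD => //; rewrite -scaleN1r; exact: cusZ.
Qed.

Lemma cus_sum (P : set A) (I : Type) (l : seq I) (F : I -> A) :
  closed_unital_subalg P -> (forall i, P (F i)) -> P (\sum_(i <- l) F i).
Proof.
move=> cP PF; elim/big_ind: _ => //; last exact: cusD.
by rewrite -(subrr 1); apply: cusB => //; exact: cus1.
Qed.

(* The norm characterisation of positivity, which needs no spectral theory. *)
Definition pos (x : A) : Prop :=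
  star x = x /\ exists2 t : R, 0 <= t & nrm (t%:C%:A - x) <= t.

Lemma starZr (r : R) x : star (r%:C *: x) = r%:C *: star x.
Proof. by rewrite starZ; congr (_ *: _); exact: conjc_real. Qed.

Lemma star_real (r : R) : star (r%:C%:A : A) = r%:C%:A.
Proof. by rewrite starZr star1. Qed.

(** Adding [d] makes (t - x) / (t + d) have norm below 1, as the iteration requires; the root is
    sqrt(t + d) (1 - r). Since it lies in every closed unital subalgebra containing [x], it commutes
    with whatever commutes with [x]. *)
Lemma pos_sqrt x (d : R) : pos x -> 0 < d ->
  exists s, [/\ star s = s, s * s = x + d%:C%:A &
    forall P, closed_unital_subalg P -> P x -> P s].
Proof.
move=> [sx [t t0 tx]] d0; have K0 : 0 < t + d by lra.
pose z := ((t + d)^-1)%:C *: (t%:C%:A - x).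
have z1 : nrm z < 1.
  rewrite nrmZ ger0_norm ?invr_ge0 1?ltW // mulrC ltr_pdivrMr //; lra.
have [r [rr rP]] := sqrt_fixpoint z1.
have c2 : Num.sqrt (t + d) * Num.sqrt (t + d) = t + d.
  by rewrite -expr2 sqr_sqrtr // ltW.
exists ((Num.sqrt (t + d))%:C *: (1 - r)); split.
- rewrite starZr starD starN star1; congr (_ *: (_ - _)).
  apply: (rP [set x | star x = x]) => /=.
  + move=> u l us ul; apply: ncvg_uniq (ncvg_star ul) _.
    by move=> e /ul[N h]; exists N => n Nn; rewrite us; exact: h.
  + exact: star0.
  + move=> y sy; rewrite starZr starD starM sy /z.
    by rewrite starZr starD starN star_real sx.
- rewrite -scalerAl -scalerAr scalerA -rmorphM /= c2.
  have -> : (1 - r) * (1 - r) = 1 - z.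
    have -> : z = r + r - r * r by rewrite rr addrK.
    rewrite mulrBl mul1r mulrBr mulr1 -addrA !opprB opprD; congr (1 + _).
    by rewrite addrCA.
  rewrite scalerBr /z scalerA -rmorphM /= divff ?gt_eqF // scale1r.
  by rewrite opprB rmorphD scalerDl addrCA addrAC subrr add0r addrC.
- move=> P cP Px; apply: cusZ => //; apply: cusB => //; first exact: cus1.
  apply: rP; first exact: cus_lim.
    by rewrite -(subrr 1); apply: cusB => //; exact: cus1.
  move=> y Py; apply: cusZ => //; apply: cusD => //; last exact: cusM.
  by apply: cusZ => //; apply: cusB => //; apply: cusZ => //; exact: cus1.
Qed.

(* [x + i s] is [c] times a unitary, of which [x] is the real part. *)
Lemma sq_sum_nrm x s (c : R) : 0 <= c -> star x = x -> star s = s ->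
  x * s = s * x -> x * x + s * s = (c * c)%:C%:A -> nrm x <= c.
Proof.
move=> c0 sx ss xs h; pose u := x + 'i%C *: s.
have su : star u = x - 'i%C *: s.
  rewrite starD starZ sx ss; congr (_ + _); rewrite -scaleNr; congr (_ *: _).
  exact: conj_i.
have uu : star u * u = (c * c)%:C%:A.
  rewrite su mulrBl !mulrDr -!scalerAl -!scalerAr xs scalerA opprD addrA addrK.
  rewrite (_ : 'i%C * 'i%C = -1 :> R[i]) -?expr2 ?sqr_i //.
  by rewrite scaleN1r opprK !expr2 h.
have uc : nrm u = c.
  apply/eqP; rewrite -(@eqrXn2 _ 2%N) ?nrm_ge0 // -nrm_starM uu nrm_real.
  by rewrite ger0_norm ?mulr_ge0 // expr2.
have : nrm (u + star u) <= c + c by rewrite (le_trans (nrmD _ _)) // nrm_star uc.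
have -> : u + star u = 2%:C *: x.
  by rewrite su addrACA subrr addr0 -mulr2n -scaler_nat rmorph_nat.
rewrite nrmZ ger0_norm //; lra.
Qed.

Lemma pos_real_sub x (c : R) : star x = x -> nrm x <= c -> pos (c%:C%:A - x).
Proof.
move=> sx xc; split; first by rewrite starD starN star_real sx.
exists c; first exact: le_trans (nrm_ge0 x) xc.
by rewrite opprB addrCA subrr addr0.
Qed.

Lemma pos_real_add x (c : R) : star x = x -> nrm x <= c -> pos (c%:C%:A + x).
Proof.
move=> sx xc; rewrite -[x]opprK; apply: pos_real_sub; last by rewrite nrmN.
by rewrite starN sx.
Qed.

Lemma posD x y : pos x -> pos y -> pos (x + y).
Proof.
move=> [sx [t t0 tx]] [sy [t' t'0 ty]]; split; first by rewrite starD sx sy.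
exists (t + t'); first exact: addr_ge0.
by rewrite rmorphD scalerDl opprD addrACA (le_trans (nrmD _ _)) // lerD.
Qed.

(** With t = |x^2| + 1 and s a root of t - x^2, the sum s^2 + x^2 is the scalar t, so |s| <= sqrt t
    and |t - x^2| = |s^2| <= t. *)
Lemma pos_sq x : star x = x -> pos (x * x).
Proof.
move=> sx; have sxx : star (x * x) = x * x by rewrite starM sx.
split=> //.
pose t := nrm (x * x) + 1.
have t0 : 0 <= t by rewrite addr_ge0 // nrm_ge0.
have tt : Num.sqrt t * Num.sqrt t = t by rewrite -expr2 sqr_sqrtr.
have [s [ss s2 sP]] := pos_sqrt (pos_real_sub sxx (lexx _)) ltr01.
have st : nrm s <= Num.sqrt t.
  apply: (@sq_sum_nrm s x); rewrite ?sqrtr_ge0 //.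
    apply: (sP _ (commutant_closed_unital x)).
    by rewrite /= mulrBl mulrBr -scalerAl -scalerAr mul1r mulr1 mulrA.
  by rewrite s2 tt addrAC subrK /t rmorphD scalerDl.
exists t => //; rewrite /t rmorphD scalerDl addrAC -s2.
rewrite (le_trans (nrmM _ _)) // -[leRHS]tt.
by apply: ler_pM => //; exact: nrm_ge0.
Qed.

Lemma pos_sum (I : Type) (l : seq I) (F : I -> A) :
  (forall i, pos (F i)) -> pos (\sum_(i <- l) F i).
Proof.
move=> h; elim/big_ind: _ => //; last exact: posD.
by split; [exact: star0|exists 0; rewrite // scale0r subrr nrm0].
Qed.

(** The roots s of c + d - x and t of c + d + x commute with x and with each other, so x^2 + (s t)^2
    = (c + d)^2 and [sq_sum_nrm] applies. *)
Lemma nrm_le_pos x (c : R) : 0 <= c -> star x = x ->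
  pos (c%:C%:A - x) -> pos (c%:C%:A + x) -> nrm x <= c.
Proof.
move=> c0 sx px py; apply/ler_addgt0Pl => d d0; rewrite addrC.
have [s [ss s2 sP]] := pos_sqrt px d0.
have [t [st t2 tP]] := pos_sqrt py d0.
have cc (k : R[i]) (u : A) : u * k%:A = k%:A * u by exact/esym/cscalC.
have xs : s * x = x * s.
  by apply: (sP _ (commutant_closed_unital x)); rewrite /= mulrBl mulrBr cc.
have xt : t * x = x * t.
  by apply: (tP _ (commutant_closed_unital x)); rewrite /= mulrDl mulrDr cc.
have ts : t * s = s * t.
  apply: (tP _ (commutant_closed_unital s)).
  by rewrite /= mulrDl mulrDr cc xs.
apply: (@sq_sum_nrm x (s * t)) => //; first by rewrite addr_ge0 // ltW.
- by rewrite starM ss st.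
- by rewrite -mulrA xt !mulrA xs.
have -> : s * t * (s * t) = (s * s) * (t * t).
  by rewrite mulrA -(mulrA s t s) ts !mulrA.
have e1 : s * s = (c + d)%:C%:A - x by rewrite s2 addrAC rmorphD scalerDl.
have e2 : t * t = (c + d)%:C%:A + x by rewrite t2 addrAC rmorphD scalerDl.
rewrite e1 e2 mulrBl !mulrDr (cc _ x) opprD [X in _ + X]addrA addrK addrCA subrr addr0.
by rewrite -scalerAl mul1r scalerA -mulrDr rmorphM.
Qed.

(** For self-adjoint y, a root s of (|y| + e)^2 - y^2 turns the bound into an algebraic identity
    that [f] preserves. The C*-identity reduces the general case to this one. *)
Lemma starhom_contractive (f : A -> A) x : is_unital_starhom f -> nrm (f x) <= nrm x.
Proof.
move=> fh.
have fZ k y : f (k *: y) = k *: f y by rewrite -!cscalE (starhomZ fh).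
have sa y : star y = y -> nrm (f y) <= nrm y.
  move=> sy; have syy : star (y * y) = y * y by rewrite starM sy.
  have cc (k : R[i]) (u : A) : u * k%:A = k%:A * u by exact/esym/cscalC.
  apply/ler_addgt0Pl => e e0; rewrite addrC.
  (* Chosen so that nrm y ^+ 2 + d = (nrm y + e) ^+ 2. *)
  pose d := nrm y * e *+ 2 + e * e.
  have y0 := nrm_ge0 y.
  have d0 : 0 < d by rewrite ltr_wpDl ?mulr_gt0 // mulrn_wge0 // mulr_ge0 // ltW.
  have [s [ss s2 sP]] := pos_sqrt (pos_real_sub syy (nrmM y y)) d0.
  have ys : s * y = y * s.
    apply: (sP _ (commutant_closed_unital y)).
    by rewrite /= mulrBl mulrBr cc mulrA.
  apply: (@sq_sum_nrm (f y) (f s)).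
  - by rewrite addr_ge0 // ltW.
  - by rewrite -(starhom_star fh) sy.
  - by rewrite -(starhom_star fh) ss.
  - by rewrite -!(starhomM fh) ys.
  have -> : f y * f y + f s * f s = f ((nrm y * nrm y + d)%:C%:A).
    rewrite -!(starhomM fh) -(starhomD fh) s2 addrC addrAC subrK.
    by rewrite -scalerDl -rmorphD.
  have -> : nrm y * nrm y + d = (nrm y + e) * (nrm y + e) by rewrite /d; ring.
  by rewrite fZ (starhom1 fh).
rewrite -(@ler_pXn2r _ 2%N) ?nnegrE ?nrm_ge0 // -!nrm_starM.
by rewrite -(starhom_star fh) -(starhomM fh) sa // starM starK.
Qed.

End Positivity.

(** * Averaging over a compact group *)

(** Compactness is used as near covering, along the filter of finite lists ordered by inclusion: a
    list that serves a point still serves it after being enlarged. *)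
Lemma compact_net (T : topologicalType) (Q : T -> T -> Prop) :
  compact [set: T] -> (forall x, \forall y \near x, Q x y) ->
  exists s : seq T, forall y, exists2 x, x \in s & Q x y.
Proof.
move=> cT nQ.
pose F : set_system (seq T) :=
  filter_from [set: seq T] (fun s => [set s' : seq T | {subset s <= s'}]).
have FF : Filter F.
  apply: filter_from_filter; first by exists [::].
  move=> s s' _ _; exists (s ++ s') => // t /= st; split=> x xs; apply: st;
    by rewrite mem_cat xs ?orbT.
have := (@compact_near_coveringP T setT).1 cT _ F
  (fun s y => exists2 x, x \in s & Q x y) FF.
case=> [x _|s _ /(_ s) sP]; last by exists s => y; exact: sP.
exists ([set y | Q x y], [set s : seq T | x \in s]) => /=.
  by split; [exact: nQ|exists [:: x] => // s /= xs; apply: xs; rewrite inE].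
by move=> [y s] /= [xy xs]; exists x.
Qed.

Section Averaging.
Variables (R : realType) (G : topGroupType) (A : cstarAlg R).
Variable alpha : cstarAction G A.
Implicit Types (x y z : A) (g h k : G).

Lemma action0 g : alpha g 0 = 0.
Proof.
have := starhomD (action_hom alpha g) 0 0; rewrite addr0 => h.
by apply: (addrI (alpha g 0)); rewrite addr0 -h.
Qed.

Lemma actionD g : {morph alpha g : x y / x + y}.
Proof. exact: (starhomD (action_hom alpha g)). Qed.

Lemma actionMx g : {morph alpha g : x y / x * y}.
Proof. exact: (starhomM (action_hom alpha g)). Qed.

Lemma action_star g : {morph alpha g : x / star x}.
Proof. exact: (starhom_star (action_hom alpha g)). Qed.

Lemma actionZ g (c : R[i]) x : alpha g (c *: x) = c *: alpha g x.
Proof. by rewrite -!cscalE (starhomZ (action_hom alpha g)). Qed.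

Lemma actionN g : {morph alpha g : x / - x}.
Proof. by move=> x; rewrite -scaleN1r actionZ scaleN1r. Qed.

Lemma actionB g : {morph alpha g : x y / x - y}.
Proof. by move=> x y; rewrite actionD actionN. Qed.

Lemma action_sum g (I : Type) (s : seq I) (P : pred I) (F : I -> A) :
  alpha g (\sum_(i <- s | P i) F i) = \sum_(i <- s | P i) alpha g (F i).
Proof. by apply: (big_morph (alpha g)); [exact: actionD|exact: action0]. Qed.

Lemma actionVK g x : alpha g (alpha g^-1%g x) = x.
Proof. by rewrite -actionM mulgV action1. Qed.

Lemma actionKV g x : alpha g^-1%g (alpha g x) = x.
Proof. by rewrite -actionM mulVg action1. Qed.

Lemma action_nrm g x : nrm (alpha g x) = nrm x.
Proof.
apply/eqP; rewrite eq_le starhom_contractive /=; last exact: action_hom.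
by rewrite -{1}(actionKV g x) starhom_contractive //; exact: action_hom.
Qed.

Lemma action_near x g (e : R) : 0 < e ->
  \forall h \near g, nrm (alpha h x - alpha g x) <= e.
Proof.
move=> e0; have e0' : 0 < e%:C by rewrite ltcR.
have /cvgrPdist_le /(_ _ e0') := @action_continuous _ _ _ alpha x g.
by apply: filterS => h; rewrite nrmE lecR nrmBC.
Qed.

Definition mean (s : seq A) : A := ((size s)%:R^-1)%:C *: \sum_(x <- s) x.

Definition mean_closed (P : set A) :=
  forall s : seq A, s != [::] -> (forall x, x \in s -> P x) -> P (mean s).

(* Membership in the convex hull of the orbit of [x], phrased through the sets
   that are closed under finite means. *)
Definition in_hull y x := forall P, mean_closed P ->
  (forall k, P (alpha k x)) -> forall k, P (alpha k y).

Lemma mean_map (I : Type) (f : I -> A) (s : seq I) :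
  mean (map f s) = ((size s)%:R^-1)%:C *: \sum_(i <- s) f i.
Proof. by rewrite /mean size_map big_map. Qed.

Lemma map_eq_nil (I J : eqType) (f : I -> J) (s : seq I) :
  (map f s == [::]) = (s == [::]).
Proof. by case: s. Qed.

Lemma nrm_mean_sub (s : seq A) z (c : R) : s != [::] ->
  \sum_(x <- s) nrm (x - z) <= (size s)%:R * c -> nrm (mean s - z) <= c.
Proof.
move=> s0 h; have n0 : 0 < (size s)%:R :> R by rewrite ltr0n lt0n size_eq0.
have -> : mean s - z = ((size s)%:R^-1)%:C *: \sum_(x <- s) (x - z).
  rewrite sumrB scalerBr -/(mean s) [in X in _ = _ - X]big_const_seq count_predT.
  rewrite iter_addr addr0 -[z *+ _]scaler_nat scalerA -(rmorph_nat (real_complex R)).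
  by rewrite -rmorphM mulVf ?gt_eqF // scale1r.
rewrite nrmZ ger0_norm ?invr_ge0 ?ler0n // mulrC ler_pdivrMr // mulrC.
exact: le_trans (nrm_sum _ _ _) h.
Qed.

Lemma ball_mean_closed z (c : R) : mean_closed [set x | nrm (x - z) <= c].
Proof.
move=> s s0 sc; apply: nrm_mean_sub => //.
rewrite big_seq (le_trans (ler_sum _ (sc : forall x, x \in s -> _))) //.
by rewrite -big_seq big_const_seq count_predT iter_addr addr0 mulr_natl.
Qed.

Lemma action_mean g (s : seq A) : alpha g (mean s) = mean (map (alpha g) s).
Proof. by rewrite mean_map actionZ action_sum. Qed.

Lemma mean_preim g h (c : R) :
  mean_closed [set x | nrm (alpha g x - alpha h x) <= c].
Proof.
move=> s s0 sc; rewrite /= !action_mean !mean_map -scalerBr -sumrB.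
rewrite -(mean_map (fun x => alpha g x - alpha h x)) -[mean _]subr0.
apply: (@ball_mean_closed 0 c); first by rewrite !map_eq_nil.
by move=> _ /mapP[x xs ->]; rewrite /= subr0; exact: sc.
Qed.

Lemma in_hull_trans y x z : in_hull x y -> in_hull y z -> in_hull x z.
Proof. by move=> xy yz P cP Pz; exact: (xy P cP (yz P cP Pz)). Qed.

Lemma in_hull_mean y x (s : seq G) : s != [::] -> in_hull y x ->
  in_hull (mean [seq alpha h y | h <- s]) x.
Proof.
move=> s0 yx P cP Px k; rewrite action_mean; apply: (cP); first by rewrite !map_eq_nil.
by move=> _ /mapP[_ /mapP[h _ ->] ->]; rewrite -actionM; exact: (yx P cP Px).
Qed.

(** Uniformity in [k] makes one net serve every element of the convex hull of the orbit of [x]. It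
    is again a near covering argument, now in the variable [k]. *)
Lemma orbit_net x (e : R) : compact [set: G] -> 0 < e ->
  exists s : seq G, forall g, exists2 h, h \in s &
    forall k, nrm (alpha g (alpha k x) - alpha h (alpha k x)) <= e.
Proof.
move=> cG e0; apply: compact_net => // h.
have cov := (@compact_near_coveringP G setT).1 cG G (nbhs h)
   (fun g k => nrm (alpha g (alpha k x) - alpha h (alpha k x)) <= e) (nbhs_filter h).
apply: filterS (cov _) => [g gP k|k _]; first exact: gP.
have e3 : 0 < e / 3 by lra.
exists ([set k' | nrm (alpha k' x - alpha k x) <= e / 3],
  [set g | nrm (alpha g (alpha k x) - alpha h (alpha k x)) <= e / 3]) => /=.
  by split; exact: action_near.
move=> [k' g] /= [k1 k2].
apply: (le_trans (nrm_dist _ (alpha g (alpha k x)) _)).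
rewrite -actionB action_nrm.
apply: (le_trans (lerD k1 (nrm_dist _ (alpha h (alpha k x)) _))).
rewrite -[alpha h _ - alpha h _]actionB action_nrm [nrm (alpha k x - _)]nrmBC.
lra.
Qed.

Definition osc_le x (d : R) := forall g, nrm (alpha g x - x) <= d.

(** An orbit point is within [d] of every term of the mean and within [e] of at least one, so its
    distance to the mean is at most ((N - 1) d + e) / N, with N the size of [s]; this is the bound
    stated. The orbit of the mean consists of means of orbit points, and balls are closed under
    means. *)
Lemma osc_mean y (s : seq G) (d e : R) : s != [::] -> e <= d -> osc_le y d ->
  (forall g, exists2 h, h \in s & nrm (alpha g y - alpha h y) <= e) ->
  osc_le (mean [seq alpha h y | h <- s]) (e + (d - e) * (1 - (size s)%:R^-1)).
Proof.
move=> s0 ed yd ye; set z := mean _; set c := e + _.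
have n0 : 0 < (size s)%:R :> R by rewrite ltr0n lt0n size_eq0.
have dist g h : nrm (alpha g y - alpha h y) <= d.
  rewrite -(action_nrm h^-1%g) actionB actionKV -actionM; exact: yd.
have zc g : nrm (alpha g y - z) <= c.
  rewrite nrmBC; apply: nrm_mean_sub; first by rewrite map_eq_nil.
  rewrite big_map size_map.
  have [h hs gh] := ye g.
  rewrite (perm_big _ (perm_to_rem hs)) big_cons nrmBC.
  have : \sum_(j <- rem h s) nrm (alpha j y - alpha g y) <= (size s).-1%:R * d.
    rewrite -(size_rem hs) mulr_natl.
    elim: (rem h s) => [|j l IH]; first by rewrite big_nil.
    by rewrite big_cons /= mulrS lerD.
  have -> : (size s).-1%:R = (size s)%:R - 1 :> R.
    by case: (s) s0 => //= a l _; rewrite -natr1 addrK.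
  move=> h2; apply: le_trans (lerD gh h2) _.
  rewrite le_eqVlt; apply/orP; left; apply/eqP; rewrite /c.
  by field; rewrite gt_eqF.
move=> g; rewrite {1}/z action_mean; apply: (@ball_mean_closed z c).
  by rewrite !map_eq_nil.
by move=> _ /mapP[_ /mapP[h _ ->] ->]; rewrite /= -actionM.
Qed.

Lemma osc_halve x (d : R) : compact [set: G] -> 0 < d -> osc_le x d ->
  exists2 y, in_hull y x & osc_le y (d / 2).
Proof.
move=> cG d0 xd; have e0 : 0 < d / 4 by lra.
have [s sP] := orbit_net x cG e0.
have s0 : s != [::] by have [h] := sP 1%g; case: (s).
have n0 : 0 < (size s)%:R^-1 :> R by rewrite invr_gt0 ltr0n lt0n size_eq0.
have n1 : (size s)%:R^-1 <= 1 :> R.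
  by rewrite invf_le1 ?ler1n ?ltr0n lt0n size_eq0.
pose q : R := 1 - (size s)%:R^-1.
have q0 : 0 <= q by rewrite subr_ge0.
have it n : exists2 y, in_hull y x & osc_le y (d / 4 + d * q ^+ n).
  elim: n => [|n [y yx yd]].
    exists x => // g; rewrite expr0 mulr1 (le_trans (xd g)) //; lra.
  exists (mean [seq alpha h y | h <- s]); first exact: in_hull_mean.
  have -> : d / 4 + d * q ^+ n.+1 =
     d / 4 + (d / 4 + d * q ^+ n - d / 4) * (1 - (size s)%:R^-1).
    by rewrite -/q exprS; ring.
  apply: osc_mean => //.
    by rewrite lerDl mulr_ge0 ?exprn_ge0 // ltW.
  (* The net was built for [x] but serves every element of its hull, so the ratio [q] is the same in
     all rounds. *)
  move=> g; have [h hs hP] := sP g; exists h => //.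
  have := yx _ (@mean_preim g h (d / 4)) hP 1%g; by rewrite action1.
(* d / 4 + d q^n falls to d / 2 once q^n <= 1 / 4. *)
have /cvgrPdist_le /(_ (1 / 4)) : (fun n => q ^+ n) @ \oo --> (0 : R).
  by apply: cvg_expr; rewrite ger0_norm // /q; lra.
case=> [|N _ /(_ N (leqnn N))]; first by lra.
rewrite sub0r normrN ger0_norm ?exprn_ge0 // => qN.
have [y yx yd] := it N; exists y => // g; apply: le_trans (yd g) _.
by have := ler_wpM2l (ltW d0) qN; lra.
Qed.

(* A substitute for averaging over the Haar measure: finite averages halve the
   oscillation along the orbit. *)
Lemma approx_fixed x (d : R) : compact [set: G] -> 0 < d -> osc_le x d ->
  exists2 y, (forall g, alpha g y = y) & nrm (y - x) <= d.
Proof.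
move=> cG d0 xd.
(* The choice is made total: where the hypotheses fail, the element itself is returned. *)
have /choice[f fP] : forall p : A * R, exists y, 0 < p.2 -> osc_le p.1 p.2 ->
    in_hull y p.1 /\ osc_le y (p.2 / 2).
  move=> [z c] /=; have [c0|c0] := ltP 0 c; last by exists z.
  have [zc|zc] := pselect (osc_le z c); last by exists z.
  by have [y yz yc] := osc_halve cG c0 zc; exists y.
pose dn n : R := d * 2^-1 ^+ n.
have dn0 n : 0 < dn n by rewrite mulr_gt0 ?exprn_gt0 ?invr_gt0.
pose u := fix u n := if n is m.+1 then f (u m, dn m) else x.
have uS n : u n.+1 = f (u n, dn n) by [].
have dnS n : dn n.+1 = dn n / 2 by rewrite /dn exprS; ring.
have uo n : osc_le (u n) (dn n).
  elim: n => [|n IH]; first by move=> g; rewrite /dn expr0 mulr1; exact: xd.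
  rewrite uS dnS; exact: (fP (u n, dn n) (dn0 n) IH).2.
have uh n : in_hull (u n.+1) (u n).
  by rewrite uS; exact: (fP (u n, dn n) (dn0 n) (uo n)).1.
have ux n : in_hull (u n) x by elim: n => // n IH; exact: in_hull_trans (uh n) IH.
have hullB y z c : in_hull y z -> osc_le z c -> nrm (y - z) <= c.
  move=> yz zc; have := yz _ (@ball_mean_closed z c) zc 1%g; by rewrite action1.
have [||y uy] := @ncvg_geometric _ _ u d 2^-1.
- by lra.
- by move=> n; exact: hullB (uh n) (uo n).
exists y => [g|].
  apply/eqP; rewrite -subr_eq0; apply/eqP/nrm_le_eps0 => e e0.
  have e3 : 0 < e / 3 by lra.
  have [N uN] := uy _ e3.
  have /cvgrPdist_le /(_ _ (divr_gt0 e3 d0))[M _ dM] :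
      (fun n => 2^-1 ^+ n) @ \oo --> (0 : R).
    by apply: cvg_expr; rewrite ger0_norm; lra.
  have {}uN := uN _ (leq_maxl N M); have {}dM := dM _ (leq_maxr N M).
  have og := uo (maxn N M) g.
  set n := maxn N M in uN dM og.
  rewrite /= sub0r normrN ger0_norm ?exprn_ge0 ?ler_pdivlMr // in dM.
  apply: (le_trans (nrm_dist _ (alpha g (u n)) _)).
  rewrite -actionB action_nrm nrmBC.
  apply: (le_trans (lerD uN (nrm_dist _ (u n) _))).
  by move: og; rewrite /dn; lra.
(* All iterates lie in the hull of the orbit of [x], hence in the closed [d]-ball about [x]; adding
   up the steps would only give 2 d. *)
apply: (@ncvg_nrm_le _ _ (fun n => u n - x)) => [|n]; last exact: hullB (ux n) xd.
by apply: ncvgD => //; exact: ncvg_cst.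
Qed.

End Averaging.

(** * Matrices and partial isometries *)

Section StarMatrices.
Variables (R : rcfType) (B : starAlgType R).

Lemma star_sum (I : Type) (s : seq I) (P : pred I) (F : I -> B) :
  star (\sum_(i <- s | P i) F i) = \sum_(i <- s | P i) star (F i).
Proof. by apply: (big_morph star); [exact: starD|exact: star0]. Qed.

Lemma star_mxD m n (M N : 'M[B]_(m, n)) : star_mx (M + N) = star_mx M + star_mx N.
Proof. by apply/matrixP => i j; rewrite !mxE starD. Qed.

Lemma star_mxN m n (M : 'M[B]_(m, n)) : star_mx (- M) = - star_mx M.
Proof. by apply/matrixP => i j; rewrite !mxE starN. Qed.

Lemma star_mxK m n (M : 'M[B]_(m, n)) : star_mx (star_mx M) = M.
Proof. by apply/matrixP => i j; rewrite !mxE starK. Qed.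

Lemma star_mxM m n l (M : 'M[B]_(m, n)) (N : 'M[B]_(n, l)) :
  star_mx (M *m N) = star_mx N *m star_mx M.
Proof.
apply/matrixP => i j; rewrite !mxE star_sum.
by apply: eq_bigr => k _; rewrite !mxE starM.
Qed.

End StarMatrices.

Section MatrixNorm.
Variables (R : realType) (A : cstarAlg R).

(** The sum of the entry norms stands in for the C*-norm of matrices: it is submultiplicative and
    invariant under [star_mx], and it controls each entry. *)
Definition mnrm m n (M : 'M[A]_(m, n)) : R := \sum_i \sum_j nrm (M i j).

Lemma mnrm_ge0 m n (M : 'M[A]_(m, n)) : 0 <= mnrm M.
Proof. by do 2!apply: sumr_ge0 => ? _; exact: nrm_ge0. Qed.

Lemma mnrm_entry m n (M : 'M[A]_(m, n)) i j : nrm (M i j) <= mnrm M.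
Proof.
rewrite /mnrm (bigD1 i) //= (bigD1 j) //= -addrA lerDl.
by rewrite addr_ge0 //; do ?apply: sumr_ge0 => ? _; exact: nrm_ge0.
Qed.

Lemma mnrm_le m n (M : 'M[A]_(m, n)) c :
  (forall i j, nrm (M i j) <= c) -> mnrm M <= (m * n)%:R * c.
Proof.
move=> h; apply: (@le_trans _ _ (\sum_(i < m) \sum_(j < n) c)).
  by do 2!apply: ler_sum => ? _.
by rewrite !sumr_const !card_ord -mulrnA mulnC mulr_natl.
Qed.

Lemma mnrmD m n (M N : 'M[A]_(m, n)) : mnrm (M + N) <= mnrm M + mnrm N.
Proof.
rewrite /mnrm -big_split ler_sum // => i _.
by rewrite -big_split ler_sum // => j _; rewrite mxE nrmD.
Qed.

Lemma mnrmN m n (M : 'M[A]_(m, n)) : mnrm (- M) = mnrm M.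
Proof. by do 2!apply: eq_bigr => ? _; rewrite mxE nrmN. Qed.

Lemma mnrm_star m n (M : 'M[A]_(m, n)) : mnrm (star_mx M) = mnrm M.
Proof.
rewrite /mnrm exchange_big; do 2!apply: eq_bigr => ? _.
by rewrite mxE nrm_star.
Qed.

Lemma mnrmM m n l (M : 'M[A]_(m, n)) (N : 'M[A]_(n, l)) :
  mnrm (M *m N) <= mnrm M * mnrm N.
Proof.
rewrite {1}/mnrm mulr_suml; apply: ler_sum => i _.
rewrite mulr_suml (@le_trans _ _ (\sum_j \sum_k nrm (M i k) * nrm (N k j))) //.
  apply: ler_sum => j _; rewrite mxE (le_trans (nrm_sum _ _ _)) //.
  by apply: ler_sum => k _; exact: nrmM.
rewrite exchange_big; apply: ler_sum => k _; rewrite -mulr_sumr.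
rewrite ler_wpM2l ?nrm_ge0 // /mnrm (bigD1 k) //= lerDl.
by do 2!apply: sumr_ge0 => ? _; exact: nrm_ge0.
Qed.

Definition mscale (r : R) m n (M : 'M[A]_(m, n)) : 'M[A]_(m, n) :=
  map_mx (fun x => r%:C *: x) M.

Lemma mnrm_mscale r m n (M : 'M[A]_(m, n)) : mnrm (mscale r M) = `|r| * mnrm M.
Proof.
rewrite /mnrm mulr_sumr; apply: eq_bigr => i _.
by rewrite mulr_sumr; apply: eq_bigr => j _; rewrite mxE nrmZ.
Qed.

Lemma mscaleMl r m n l (M : 'M[A]_(m, n)) (N : 'M[A]_(n, l)) :
  mscale r M *m N = mscale r (M *m N).
Proof.
apply/matrixP => i j; rewrite !mxE scaler_sumr.
by apply: eq_bigr => k _; rewrite mxE scalerAl.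
Qed.

Lemma mscaleMr r m n l (M : 'M[A]_(m, n)) (N : 'M[A]_(n, l)) :
  M *m mscale r N = mscale r (M *m N).
Proof.
apply/matrixP => i j; rewrite !mxE scaler_sumr.
by apply: eq_bigr => k _; rewrite mxE scalerAr.
Qed.

Lemma mscale_star r m n (M : 'M[A]_(m, n)) : star_mx (mscale r M) = mscale r (star_mx M).
Proof. by apply/matrixP => i j; rewrite !mxE starZr. Qed.

Lemma mscale_half m n (M : 'M[A]_(m, n)) : mscale 2^-1 M + mscale 2^-1 M = M.
Proof.
apply/matrixP => i j; rewrite !mxE -scalerDl -rmorphD /=.
by rewrite (_ : 2^-1 + 2^-1 = 1 :> R) ?scale1r //; lra.
Qed.

Lemma ncvg_sum (I : Type) (s : seq I) (u : I -> nat -> A) (l : I -> A) :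
  (forall i, ncvg (u i) (l i)) ->
  ncvg (fun k => \sum_(i <- s) u i k) (\sum_(i <- s) l i).
Proof.
move=> h; elim: s => [|i s IH].
  rewrite big_nil => e e0; exists 0%N => k _.
  by rewrite big_nil subrr nrm0 ltW.
rewrite big_cons => e /(ncvgD (h i) IH)[N hN]; exists N => k Nk.
by rewrite big_cons; exact: hN.
Qed.

Lemma ncvg_mulmx m n l (u : nat -> 'M[A]_(m, n)) (v : nat -> 'M[A]_(n, l))
    (M : 'M[A]_(m, n)) (N : 'M[A]_(n, l)) :
  (forall i j, ncvg (fun k => u k i j) (M i j)) ->
  (forall i j, ncvg (fun k => v k i j) (N i j)) ->
  forall i j, ncvg (fun k => (u k *m v k) i j) ((M *m N) i j).
Proof.
move=> uM vN i j; rewrite mxE => e.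
have := @ncvg_sum _ (index_enum 'I_n) (fun c k => u k i c * v k c j) _
  (fun c => ncvgM (uM i c) (vN c j)).
by move=> h /h[K hK]; exists K => k Kk; rewrite mxE; exact: hK.
Qed.

(** * Newton-Schulz iteration with unit [p] *)

Section NewtonSchulz.
Variables (m n : nat) (p : 'M[A]_m) (q : 'M[A]_n).
Hypothesis pp : is_projection p.

Definition ns_err (w : 'M[A]_(n, m)) := p - star_mx w *m w.
(** When w p = w this is w (3 - w^* w) / 2, the Newton-Schulz step towards the polar part of w. *)
Definition ns_step (w : 'M[A]_(n, m)) := w + mscale 2^-1 (w *m ns_err w).

Lemma ns_step_mulr w : w *m p = w -> ns_step w *m p = ns_step w.
Proof.
move=> wp; rewrite mulmxDl wp mscaleMl -mulmxA /ns_err mulmxBl -mulmxA wp.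
by rewrite pp.1.
Qed.

(** Since w^* w = p - e is a polynomial in e, all factors commute, and the new error is (3 e^2 +
    e^3) / 4. *)
Lemma ns_err_step w : w *m p = w ->
  ns_err (ns_step w) = ns_err w *m ns_err w
    - mscale 2^-1 (mscale 2^-1 (ns_err w *m ns_err w - ns_err w *m ns_err w *m ns_err w)).
Proof.
move=> wp; set e := ns_err w.
have pw : p *m star_mx w = star_mx w by rewrite -{1}pp.2 -star_mxM wp.
have es : star_mx e = e by rewrite star_mxD star_mxN star_mxM star_mxK pp.2.
have pe : p *m e = e by rewrite mulmxBr mulmxA pw pp.1.
have ep : e *m p = e by rewrite mulmxBl -mulmxA wp pp.1.
have S : star_mx w *m w = p - e by rewrite opprB addrCA subrr addr0.
have eE : ns_err w = e by [].
clearbody e; rewrite {1}/ns_err {1 2}/ns_step eE star_mxD mscale_star star_mxM es.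
rewrite mulmxDl !mulmxDr !mscaleMl !mscaleMr !mulmxA -(mulmxA e (star_mx w) w) S.
rewrite mulmxBr !mulmxBl ep pe.
set f := e *m e; set g := f *m e.
have -> : p - e + mscale 2^-1 (e - f) +
    (mscale 2^-1 (e - f) + mscale 2^-1 (mscale 2^-1 (f - g)))
  = p - f + mscale 2^-1 (mscale 2^-1 (f - g)).
  rewrite addrA -(addrA (p - e)) mscale_half; congr (_ + _).
  by rewrite addrA subrK.
by rewrite opprD addrA opprB addrCA subrr addr0.
Qed.

(** The decrease is quadratic, but halving is enough to make the increments geometric. *)
Lemma ns_err_small w (c : R) : w *m p = w -> c <= 4^-1 -> mnrm (ns_err w) <= c ->
  mnrm (ns_err (ns_step w)) <= c / 2.
Proof.
move=> wp c4 wc; rewrite ns_err_step //; set e := ns_err w in wc *.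
have e0 := mnrm_ge0 e.
have h2 : `|2^-1| = 2^-1 :> R by rewrite ger0_norm // invr_ge0.
apply: (le_trans (mnrmD _ _)); rewrite mnrmN !mnrm_mscale h2.
have ee := mnrmM e e; have eee := mnrmM (e *m e) e.
have d := mnrmD (e *m e) (- (e *m e *m e)); rewrite mnrmN in d.
have ee' : mnrm e * mnrm e <= c * 4^-1.
  by apply: ler_pM => //; exact: le_trans wc c4.
have eee' : mnrm (e *m e) * mnrm e <= c * 4^-1 * 4^-1.
  apply: ler_pM => //; rewrite ?mnrm_ge0 //; first exact: le_trans ee ee'.
  exact: le_trans wc c4.
have c0 := le_trans e0 wc; lra.
Qed.

(* Newton-Schulz iteration for the polar part of an approximate partial
   isometry; it needs no functional calculus. *)
Lemma exact_partial_isometry (P : set A) (X : 'M[A]_(n, m)) :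
  closed_unital_subalg P -> (forall x, P x -> P (star x)) ->
  (forall i j, P (p i j)) -> (forall i j, P (X i j)) ->
  X *m p = X -> q *m X = X -> mnrm (p - star_mx X *m X) <= 4^-1 ->
  exists w : 'M[A]_(n, m),
    [/\ forall i j, P (w i j), star_mx w *m w = p & q *m w = w].
Proof.
move=> cP Pstar Pp PX Xp qX X4.
pose u k := iter k ns_step X.
have uS k : u k.+1 = ns_step (u k) by [].
have up k : u k *m p = u k by elim: k => // k IH; rewrite uS; exact: ns_step_mulr.
have qu k : q *m u k = u k.
  by elim: k => // k IH; rewrite uS mulmxDr mscaleMr mulmxA IH.
have t0 k : 0 <= 2^-1 ^+ k :> R by rewrite exprn_ge0 // invr_ge0.
have t1 k : 2^-1 ^+ k <= 1 :> R by rewrite exprn_ile1 // ?invr_ge0 //; lra.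
have ue k : mnrm (ns_err (u k)) <= 4^-1 * 2^-1 ^+ k.
  elim: k => [|k IH]; first by rewrite expr0 mulr1.
  rewrite exprS mulrCA mulrC uS; apply: ns_err_small => //.
  by have := t1 k; lra.
have C0 := mnrm_ge0 X; set C := mnrm X in C0.
have h2 : `|2^-1| = 2^-1 :> R by rewrite ger0_norm // invr_ge0.
have du k : mnrm (u k.+1 - u k) <= mnrm (u k) * (8^-1 * 2^-1 ^+ k).
  rewrite uS addrAC subrr add0r mnrm_mscale h2.
  have := mnrmM (u k) (ns_err (u k)).
  have := ler_wpM2l (mnrm_ge0 (u k)) (ue k); lra.
(* The uniform bound 2 C is not inductive by itself; the term 2^-k leaves room for the factor 1 +
   2^-k / 8 gained at step k. *)
have ub k : mnrm (u k) <= C * (2 - 2^-1 ^+ k).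
  elim: k => [|k IH]; first by rewrite expr0 /= /C; lra.
  rewrite -[u k.+1](subrK (u k)) (le_trans (mnrmD _ _)) //.
  apply: (le_trans (lerD (du k) (lexx _))).
  have := t0 k; have := t1 k; rewrite exprS; set t := 2^-1 ^+ k => t1' t0'.
  have a : mnrm (u k) * (8^-1 * t) + mnrm (u k) = mnrm (u k) * (1 + 8^-1 * t) by ring.
  rewrite a (@le_trans _ _ (C * (2 - t) * (1 + 8^-1 * t))) //.
    by rewrite ler_wpM2r //; lra.
  by rewrite -mulrA ler_wpM2l //; nra.
have Pe k : (forall i j, P (u k i j)) -> forall i j, P (ns_step (u k) i j).
  move=> Pu i j; rewrite !mxE; apply: cusD => //; apply: cusZ => //.
  apply: cus_sum => // c; apply: cusM => //; rewrite !mxE; apply: cusB => //.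
  by apply: cus_sum => // d; apply: cusM => //; rewrite mxE; exact: Pstar.
have Pu k i j : P (u k i j) by elim: k i j => // k IH; exact: Pe.
have /choice[l ul] : forall ij : 'I_n * 'I_m, exists x,
    ncvg (fun k => u k ij.1 ij.2) x.
  move=> [i j] /=; apply: (@ncvg_geometric _ _ _ (C * 4^-1) 2^-1); first by lra.
  move=> k; have -> : u k.+1 i j - u k i j = (u k.+1 - u k) i j by rewrite !mxE.
  apply: (le_trans (mnrm_entry _ _ _)); apply: (le_trans (du k)).
  have : mnrm (u k) <= C * 2 by apply: (le_trans (ub k)); rewrite ler_wpM2l // gerBl.
  by move=> /(ler_wpM2r (t0 k)); lra.
pose w := \matrix_(i, j) l (i, j).
have uw i j : ncvg (fun k => u k i j) (w i j) by rewrite mxE; exact: ul (i, j).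
clearbody w; exists w; split.
- by move=> i j; apply: (cus_lim cP) (uw i j) => k.
- apply/matrixP => i j; apply: (@ncvg_uniq _ _ (fun k => (star_mx (u k) *m u k) i j)).
    by apply: ncvg_mulmx; [move=> a b; rewrite mxE|exact: uw];
      move=> e /(ncvg_star (uw b a))[N hN]; exists N => k Nk; rewrite !mxE; exact: hN.
  move=> e e0.
  have /cvgrPdist_le /(_ _ e0)[N _ hN] : (fun n => 2^-1 ^+ n) @ \oo --> (0 : R).
    by apply: cvg_expr; rewrite ger0_norm; lra.
  exists N => k /hN /=; rewrite sub0r normrN ger0_norm // => he.
  have -> : (star_mx (u k) *m u k) i j - p i j = - ns_err (u k) i j.
    by rewrite !mxE opprB.
  rewrite nrmN; apply: (le_trans (mnrm_entry _ _ _)); apply: (le_trans (ue k)); lra.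
apply/matrixP => i j; apply: (@ncvg_uniq _ _ (fun k => u k i j)) (uw i j).
move=> e; have := @ncvg_mulmx _ _ _ (fun=> q) u q w _ uw i j e.
rewrite /= => h e0; have [|N hN] := h _ e0.
  by move=> a b; exact: ncvg_cst.
by exists N => k Nk; rewrite -(qu k); exact: hN.
Qed.

End NewtonSchulz.
End MatrixNorm.

(** * Separable invariant subalgebras *)

Lemma countable_union T (X Y : set T) :
  countable X -> countable Y -> countable (X `|` Y).
Proof.
move=> cX cY; have -> : X `|` Y = \bigcup_(b in [set: bool]) if b then X else Y.
  rewrite eqEsubset; split=> x; first by case=> h; [exists true|exists false].
  by case=> -[] _ h; [left|right].
by apply: bigcup_countable => // -[].
Qed.

Lemma countable_image T U (f : T -> U) (X : set T) :
  countable X -> countable (f @` X).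
Proof. exact: (sub_countable (card_image_le f X)). Qed.

Section InvariantSubalgebra.
Variables (R : realType) (G : topGroupType) (A : cstarAlg R).
Variable alpha : cstarAction G A.

Lemma closure_ncvg (E : set A) x :
  closure E x <-> exists2 u, (forall n, E (u n)) & ncvg u x.
Proof.
split=> [xE|[u uE ux]]; last first.
  apply: (closed_ncvg (@closed_closure _ E)) ux => n.
  exact: subset_closure.
have /choice[u uP] : forall n, exists y, E y /\ nrm (y - x) < n.+1%:R^-1.
  move=> n; have n0 : 0 < n.+1%:R^-1 :> R by rewrite invr_gt0 ltr0n.
  have [|y [Ey]] := xE (ball x (n.+1%:R^-1)%:C).
    by apply: nbhsx_ballx; rewrite ltcR.
  by rewrite -ball_normE /= nrmE ltcR nrmBC => xy; exists y.
exists u => [n|e e0]; first by have [] := uP n.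
have /cvgrPdist_le /(_ _ e0)[N _ hN] := @cvg_harmonic R.
exists N => n /hN /=; rewrite sub0r normrN ger0_norm ?invr_ge0 //= => ne.
by rewrite (le_trans _ ne) // ltW // (uP n).2.
Qed.

Definition ratC (q : rat * rat) : R[i] := ratr q.1 +i* ratr q.2.

Lemma ratC_near (k : R[i]) (e : R) : 0 < e ->
  exists q, nrm ((ratC q)%:A - k%:A : A) <= e.
Proof.
move=> e0; case: k => a b.
have near_rat (c : R) : exists q : rat, `|ratr q - c| <= e / 2.
  have [q] := @rat_in_itvoo R (c - e / 2) (c + e / 2) ltac:(lra).
  by rewrite in_itv /= => /andP[q1 q2]; exists q; rewrite ler_norml; lra.
have [p pa] := near_rat a; have [q qb] := near_rat b; exists (p, q).
have -> : (ratC (p, q))%:A - (a +i* b)%:A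
    = (ratr p - a)%:C%:A + 'i%C *: (ratr q - b)%:C%:A :> A.
  rewrite -scalerBl scalerA -scalerDl; congr (_ *: _).
  by apply/eqP; rewrite eq_complex /= !(mul0r, mulr0, mul1r, subr0, addr0, add0r) !eqxx.
apply: (le_trans (nrmD _ _)); rewrite nrmZi !nrm_real; lra.
Qed.

Variables (I : countType) (v : I -> A).

Definition gen_step (E : set A) : set A :=
  E `|` [set p.1 + p.2 | p in E `*` E] `|` [set p.1 * p.2 | p in E `*` E] `|`
  star @` E.

Lemma gen_step_countable E : countable E -> countable (gen_step E).
Proof.
move=> cE; have cEE : countable (E `*` E) by exact: countableX.
by do ?apply: countable_union => //; exact: countable_image.
Qed.

(** The orbits may be uncountable, so only countable dense parts of them are taken as generators,
    together with the rational complex multiples of 1, whose presence makes the closure stable under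
    scaling. *)
Lemma separable_invariant_subalg : compact [set: G] ->
  exists D : cstarSubAlg A, [/\ separable_sub D, invariant_sub alpha D,
    csub_set D 1 & forall i, csub_set D (v i)].
Proof.
move=> cG.
have /choice[s sP] : forall p : I * nat, exists s : seq G, forall g,
    exists2 h, h \in s & nrm (alpha g (v p.1) - alpha h (v p.1)) <= p.2.+1%:R^-1.
  move=> [i n] /=; have n0 : 0 < n.+1%:R^-1 :> R by rewrite invr_gt0 ltr0n.
  have [s sP] := orbit_net alpha (v i) cG n0; exists s => g.
  by have [h hs /(_ 1%g)] := sP g; rewrite !action1; exists h.
pose L : set A := range (fun q => (ratC q)%:A) `|`
  range (fun p : I * nat * nat => alpha (nth 1%g (s p.1) p.2) (v p.1.1)).
pose En n := iter n gen_step L.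
pose E := \bigcup_n En n.
have EnS n : En n `<=` En n.+1 by move=> x xn; do 3!left.
have Enle n k : (n <= k)%N -> En n `<=` En k.
  by move/subnK <-; elim: (k - n)%N => // l IH x /IH; exact: EnS.
have cE : countable E.
  apply: bigcup_countable => // n _; elim: n => [|n IH].
    by apply: countable_union; exact: countable_image.
  exact: gen_step_countable.
have LE : L `<=` E by move=> x Lx; exists 0%N.
have Epair x y : E x -> E y -> exists2 n, En n x & En n y.
  move=> [n _ xn] [k _ yk]; exists (maxn n k).
    by apply: Enle xn; exact: leq_maxl.
  by apply: Enle yk; exact: leq_maxr.
have ED x y : E x -> E y -> E (x + y).
  move=> Ex Ey; have [n xn yn] := Epair _ _ Ex Ey.
  by exists n.+1 => //; left; left; right; exists (x, y).
have EM x y : E x -> E y -> E (x * y).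
  move=> Ex Ey; have [n xn yn] := Epair _ _ Ex Ey.
  by exists n.+1 => //; left; right; exists (x, y).
have Es x : E x -> E (star x) by move=> [n _ xn]; exists n.+1 => //; right; exists x.
have Dscal k : closure E k%:A.
  have /choice[q qP] n := @ratC_near k n.+1%:R^-1 ltac:(by rewrite invr_gt0 ltr0n).
  apply/closure_ncvg; exists (fun n => (ratC (q n))%:A).
    by move=> n; apply: LE; left; exists (q n).
  move=> e e0; have /cvgrPdist_le /(_ _ e0)[N _ hN] := @cvg_harmonic R.
  exists N => n /hN /=; rewrite sub0r normrN ger0_norm ?invr_ge0 //= => ne.
  exact: le_trans (qP n) ne.
have DD x y : closure E x -> closure E y -> closure E (x + y).
  move=> /closure_ncvg[u uE ux] /closure_ncvg[w wE wy]; apply/closure_ncvg.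
  by exists (fun n => u n + w n) => [n|]; [exact: ED|exact: ncvgD].
have DM x y : closure E x -> closure E y -> closure E (x * y).
  move=> /closure_ncvg[u uE ux] /closure_ncvg[w wE wy]; apply/closure_ncvg.
  by exists (fun n => u n * w n) => [n|]; [exact: EM|exact: ncvgM].
have Ds x : closure E x -> closure E (star x).
  move=> /closure_ncvg[u uE ux]; apply/closure_ncvg.
  by exists (fun n => star (u n)) => [n|]; [exact: Es|exact: ncvg_star].
have DZ (k : R[i]) x : closure E x -> closure E (k *: x).
  by move=> Dx; rewrite -[x]mul1r scalerAl; exact: DM.
have D0 : closure E 0 by rewrite -(scale0r (1 : A)); exact: Dscal.
pose D := CStarSubAlg D0 DD DZ DM Ds (@closed_closure _ E).
have Dorb g i : closure E (alpha g (v i)).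
  have /choice[h hP] n : exists k, k \in s (i, n) /\
      nrm (alpha g (v i) - alpha k (v i)) <= n.+1%:R^-1.
    by have [k k1 k2] := sP (i, n) g; exists k.
  apply/closure_ncvg; exists (fun n => alpha (h n) (v i)).
    move=> n; apply: LE; right; exists (i, n, index (h n) (s (i, n))) => //=.
    by rewrite nth_index // (hP n).1.
  move=> e e0; have /cvgrPdist_le /(_ _ e0)[N _ hN] := @cvg_harmonic R.
  exists N => n /hN /=; rewrite sub0r normrN ger0_norm ?invr_ge0 //= => ne.
  by rewrite nrmBC; exact: le_trans (hP n).2 ne.
exists D; split => //=.
- by exists E; split => //; exact: subset_closure.
- move=> g x /closure_ncvg[u uE ux].
  apply: (closed_ncvg (@closed_closure _ E)) (_ : ncvg (fun n => alpha g (u n)) _).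
    (* Induction on the generation stage: [alpha g] sends a generator to an orbit point or a scalar,
       hence into the closure of [E], though not necessarily into [E]. *)
    move=> n; have [k _] := uE n; elim: k (u n) => [|k IH] y.
      case=> [[q _ <-]|[[[i l] j] _ <-]] /=.
        by rewrite actionZ (starhom1 (action_hom alpha g)).
      by rewrite -actionM.
    case=> [[[|]|]|]; first exact: IH.
    + by move=> [[a b] [/= ak bk] <-]; rewrite actionD; apply: (DD); exact: IH.
    + by move=> [[a b] [/= ak bk] <-]; rewrite actionMx; apply: (DM); exact: IH.
    + by move=> [a ak <-]; rewrite action_star; apply: (Ds); exact: IH.
  by apply: (@ncvg_lip _ _ _ 1) => // n; rewrite -actionB action_nrm mul1r.
- by rewrite -(scale1r (1 : A)).
- by move=> i; have := Dorb 1%g i; rewrite action1.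
Qed.

End InvariantSubalgebra.

(** * Sequence algebras *)

Section SequenceAlgebraTheory.
Variables (R : realType) (A : cstarAlg R).
Notation linf := (sub_alg (linfty A)).
Implicit Types (a b : linf).

Lemma eta_eqP a b : eta a = eta b <-> forall e : R, 0 < e ->
  exists N, forall n, (N <= n)%N -> nrm (sub_val a n - sub_val b n) <= e.
Proof.
have E := @quot_piP R _ (c0 A) a b.
have {}E : eta a = eta b <-> ncvg (fun n => sub_val a n - sub_val b n) 0.
  by rewrite ncvgP.
rewrite E; split=> h e /h[N hN]; exists N => n /hN; by rewrite subr0.
Qed.

Lemma etaD : {morph @eta R A : a b / a + b}. Proof. exact: quot_piD. Qed.
Lemma etaM : {morph @eta R A : a b / a * b}. Proof. exact: quot_piM. Qed.
Lemma eta_star a : eta (star a) = star (eta a). Proof. exact: quot_pi_star. Qed.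
Lemma eta1 : eta (1 : linf) = 1. Proof. by []. Qed.
Lemma eta_cscal k : eta (cscal k : linf) = cscal k. Proof. by []. Qed.
Lemma eta_reprK : cancel (@eta_repr R A) (@eta R A).
Proof. exact: quot_reprK. Qed.

Lemma linfty_nrmP (f : nat -> A) :
  sub_set (linfty A) f <-> exists M : R, forall n, nrm (f n) <= M.
Proof.
split=> [[M fM]|[M fM]]; last by exists M%:C => n; rewrite nrmE lecR.
exists (complex.Re M) => n; have := fM n; rewrite nrmE lecE => /andP[_]; exact.
Qed.

Lemma const_eta (d : A) (f : nat -> A) (fb : sub_set (linfty A) f) :
  (forall n, f n = d) -> eta (to_sub fb) = const_Ainfty d.
Proof.
move=> fd; apply/eta_eqP => e e0; exists 0%N => n _.
by rewrite /= fd subrr nrm0 ltW.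
Qed.

End SequenceAlgebraTheory.

(** * Lifting the Rokhlin map to the sequence algebra *)

Section RokhlinMap.
Variables (R : realType) (G : topGroupType) (A : cstarAlg R).
Variable alpha : cstarAction G A.
Notation linf := (sub_alg (linfty A)).

Lemma act_linftyE g (a : linf) n :
  sub_val (act_linfty alpha g a) n = alpha g (sub_val a n).
Proof.
rewrite /act_linfty -[sub_val (insubd _ _)]/(val (insubd _ _)) insubdK //.
rewrite unfold_in /= inE; apply/linfty_nrmP.
have /linfty_nrmP[M aM] := sub_algP a.
by exists M => n'; rewrite action_nrm.
Qed.

Lemma linfty_cont_near (a : linf) g (e : R) : linfty_cont alpha a -> 0 < e ->
  \forall h \near g, forall n,
    nrm (alpha h (sub_val a n) - alpha g (sub_val a n)) <= e.
Proof.
move=> ca e0; have e0' : 0 < e%:C by rewrite ltcR.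
have := ca g [set f | forall n, nrm (f n - alpha g (sub_val a n)) <= e].
rewrite /= => H.
have : \forall h \near g, forall n,
    nrm (sub_val (act_linfty alpha h a) n - alpha g (sub_val a n)) <= e.
  apply: H; apply/uniform_nbhs.
  exists [set xy : A * A | ball xy.1 e%:C xy.2]; split.
    by rewrite -entourage_ballE; exists e%:C.
  move=> f fa n; have /= := fa n I.
  by rewrite act_linftyE -ball_normE /= nrmE ltcR nrmBC => /ltW.
by apply: filterS => h ha n; rewrite -act_linftyE.
Qed.

Record rokhlin_map (D : cstarSubAlg A)
    (Phi : sub_alg (cont_fun R G) -> Ainfty A) : Prop := RokhlinMap {
  rm_hom : is_unital_starhom Phi;
  rm_com : forall f d, csub_set D d ->
    Phi f * const_Ainfty d = const_Ainfty d * Phi f;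
  rm_lift : forall f, exists2 a, linfty_cont alpha a & eta a = Phi f;
  rm_equiv : forall g f a, eta a = Phi f ->
    eta (act_linfty alpha g a) = Phi (Lt g f)
}.

Lemma act_linfty_eta g (a b : linf) : eta a = eta b ->
  eta (act_linfty alpha g a) = eta (act_linfty alpha g b).
Proof.
move=> /eta_eqP ab; apply/eta_eqP => e /ab[N hN]; exists N => n Nn.
by rewrite !act_linftyE -actionB action_nrm hN.
Qed.

(** As [D] contains 1, the annihilator of [D] is zero and [kappa] is injective, so taking
    representatives is itself a homomorphism, with values in the commutant of [D]. *)
Lemma Rokhlin_map (D : cstarSubAlg A) : Rokhlin alpha -> separable_sub D ->
  invariant_sub alpha D -> csub_set D 1 -> exists Phi, rokhlin_map D Phi.
Proof.
move=> rok sD iD D1; have [phi [hphi cphi ephi]] := rok D sD iD.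
have c1 : const_Ainfty (1 : A) = 1.
  by rewrite -eta1; apply/eta_eqP => e e0; exists 0%N => n _; rewrite subrr nrm0 ltW.
have kinj (x y : sub_alg (commutant D)) : kappa x = kappa y -> sub_val x = sub_val y.
  move=> /quot_piP /(_ 1 D1)[]; rewrite c1 mulr1 => h _.
  by apply/eqP; rewrite -subr_eq0; apply/eqP.
have kK x : kappa (@kappa_repr _ _ D x) = x by exact: quot_reprK.
exists (fun f => sub_val (kappa_repr (phi f))); split.
- have [h1 h2 h3 h4 h5] := hphi; split.
  + move=> f f'; rewrite -sub_valD; apply: kinj.
    by rewrite kK h1 -{1}(kK (phi f)) -{1}(kK (phi f')) -quot_piD.
  + move=> f f'; rewrite -sub_valM; apply: kinj.
    by rewrite kK h2 -{1}(kK (phi f)) -{1}(kK (phi f')) -quot_piM.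
  + rewrite -[RHS]/(sub_val (1 : sub_alg (commutant D))); apply: kinj.
    by rewrite kK h3.
  + move=> k f.
    rewrite -[cscal k in RHS]/(sub_val (cscal k : sub_alg (commutant D))) -sub_valM.
    by apply: kinj; rewrite kK h4 -{1}(kK (phi f)) -quot_pi_cscal -quot_piM.
  + move=> f; rewrite -sub_val_star; apply: kinj.
    by rewrite kK h5 -{1}(kK (phi f)) -quot_pi_star.
- by move=> f d Dd; exact: (sub_algP (kappa_repr (phi f)) d Dd).
- move=> f; have [x [a ca ax] xf] := cphi f.
  exists a => //; rewrite ax; apply: kinj; by rewrite kK xf.
move=> g f a af.
have fE := ephi g f; rewrite /act_F in fE.
(* Needed for [insubd] not to return its default: commuting with d after applying alpha_g is
   commuting with alpha_{g^-1}(d) before, and [D] is invariant. *)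
have com : act_Ainfty alpha g (sub_val (kappa_repr (phi f)))
    \in Defs.sub_mem (commutant D).
  rewrite unfold_in /= inE => d Dd; rewrite /act_Ainfty.
  have Dd' : csub_set D (alpha g^-1%g d) by exact: iD.
  have := sub_algP (kappa_repr (phi f)) _ Dd'.
  rewrite -{1 2}(eta_reprK (sub_val (kappa_repr (phi f)))) /const_Ainfty -!etaM.
  move=> /eta_eqP h; apply/eta_eqP => e /h[N hN]; exists N => n /hN.
  rewrite -(action_nrm alpha g) actionB /= !mulrfctE /= !actionMx actionVK.
  by rewrite act_linftyE.
rewrite -(kK (phi (Lt g f))) in fE; move/kinj: fE => ->.
rewrite -[RHS]/(val (insubd _ _)) insubdK // /act_Ainfty.
by apply: act_linfty_eta; rewrite af eta_reprK.
Qed.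

End RokhlinMap.

(** * Norm bounds in the sequence algebra *)

Section AsymptoticNorm.
Variables (R : realType) (A : cstarAlg R).
Notation linf := (sub_alg (linfty A)).
Implicit Types (a b : linf) (x y : Ainfty A).

Lemma eta0 : eta (0 : linf) = 0.
Proof. by apply: (addrI (eta 0)); rewrite -etaD !addr0. Qed.

Lemma etaN : {morph @eta R A : a / - a}.
Proof. by move=> a; apply: (addrI (eta a)); rewrite -etaD !subrr eta0. Qed.

Lemma eta_sum (I : Type) (s : seq I) (F : I -> linf) :
  eta (\sum_(i <- s) F i) = \sum_(i <- s) eta (F i).
Proof. by apply: (big_morph (@eta R A)); [exact: etaD|exact: eta0]. Qed.

Lemma sub_val_sum_at (I : Type) (s : seq I) (F : I -> linf) n :
  sub_val (\sum_(i <- s) F i) n = \sum_(i <- s) (sub_val (F i) n : A).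
Proof. by apply: (big_morph (fun a : linf => sub_val a n : A)). Qed.

Lemma const_AinftyD : {morph @const_Ainfty R A : x y / x + y}.
Proof.
move=> d d'; rewrite /const_Ainfty -etaD; apply/eta_eqP => e e0.
by exists 0%N => n _; rewrite subrr nrm0 ltW.
Qed.

Lemma const_AinftyM : {morph @const_Ainfty R A : x y / x * y}.
Proof.
move=> d d'; rewrite /const_Ainfty -etaM; apply/eta_eqP => e e0.
by exists 0%N => n _; rewrite subrr nrm0 ltW.
Qed.

Lemma const_Ainfty_cscal k : @const_Ainfty R A (cscal k) = cscal k.
Proof.
rewrite /const_Ainfty -eta_cscal; apply/eta_eqP => e e0.
by exists 0%N => n _; rewrite subrr nrm0 ltW.
Qed.

Lemma const_AinftyZ k d : @const_Ainfty R A (k *: d) = cscal k * const_Ainfty d.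
Proof. by rewrite -cscalE const_AinftyM const_Ainfty_cscal. Qed.

Lemma const_Ainfty0 : @const_Ainfty R A 0 = 0.
Proof. by rewrite -(cscal0 A) const_Ainfty_cscal cscal0. Qed.

Lemma const_AinftyN : {morph @const_Ainfty R A : x / - x}.
Proof. by move=> d; rewrite -cscalN1 const_AinftyM const_Ainfty_cscal cscalN1. Qed.

Lemma const_Ainfty_sum (I : Type) (s : seq I) (F : I -> A) :
  const_Ainfty (\sum_(i <- s) F i) = \sum_(i <- s) const_Ainfty (F i).
Proof.
by apply: (big_morph (@const_Ainfty R A)); [exact: const_AinftyD|exact: const_Ainfty0].
Qed.

(* The norm of [x] in the sequence algebra, i.e. the limsup of the norms along
   any lift, is at most [c]. *)
Definition nle x (c : R) := forall a, eta a = x -> forall e : R, 0 < e ->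
  exists N, forall n, (N <= n)%N -> nrm (sub_val a n : A) <= c + e.

Lemma nle_lift a (c : R) : (forall e : R, 0 < e ->
    exists N, forall n, (N <= n)%N -> nrm (sub_val a n : A) <= c + e) ->
  nle (eta a) c.
Proof.
move=> ac b /eta_eqP ba e e0; have [N hN] := ac _ (halfr_gt0 e0).
have [M hM] := ba _ (halfr_gt0 e0); exists (maxn N M) => n.
rewrite geq_max => /andP[/hN h1 /hM h2].
rewrite -[sub_val b n](subrK (sub_val a n)) (le_trans (nrmD _ _)) //; lra.
Qed.

Lemma nle_approx x (c : R) : (forall e : R, 0 < e -> nle x (c + e)) -> nle x c.
Proof.
move=> h a ax e e0; have [N hN] := h _ (halfr_gt0 e0) a ax _ (halfr_gt0 e0).
by exists N => n /hN; rewrite -addrA -splitr.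
Qed.

Lemma nleD x y (c d : R) : nle x c -> nle y d -> nle (x + y) (c + d).
Proof.
move=> xc yd; rewrite -(eta_reprK x) -(eta_reprK y) -etaD; apply: nle_lift => e e0.
have [N hN] := xc _ (eta_reprK x) _ (halfr_gt0 e0).
have [M hM] := yd _ (eta_reprK y) _ (halfr_gt0 e0); exists (maxn N M) => n.
rewrite geq_max => /andP[/hN h1 /hM h2].
rewrite (le_trans (nrmD _ _)) //; lra.
Qed.

Lemma nle_scali x (c : R) : nle x c -> nle (cscal 'i%C * x) c.
Proof.
move=> xc; rewrite -(eta_reprK x) -eta_cscal -etaM; apply: nle_lift => e e0.
have [N hN] := xc _ (eta_reprK x) _ e0; exists N => n /hN.
by rewrite sub_valM mulrfctE /= cscalE nrmZi.
Qed.

Lemma selfadjoint_lift x : star x = x -> exists2 a, eta a = x & star a = a.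
Proof.
move=> sx; exists (cscal (2^-1)%:C * (eta_repr x + star (eta_repr x))).
  rewrite etaM etaD eta_star eta_reprK sx eta_cscal mulrDr -mulrDl -cscalD.
  by rewrite -rmorphD /= (_ : 2^-1 + 2^-1 = 1 :> R) ?cscal1 ?mul1r //; lra.
rewrite starM starD starK star_cscal cscalC [star _ + _]addrC.
by congr (_ * cscal _); exact: conjc_real.
Qed.

(* The sums of squares are lifted to the algebra, where they dominate the lifts
   of [c - x] and [c + x] up to a null sequence. *)
Lemma nle_sum_sq (I : finType) x (c : R) (P Q : I -> Ainfty A) : 0 <= c ->
  star x = x -> (forall i, star (P i) = P i) -> (forall i, star (Q i) = Q i) ->
  cscal c%:C - x = \sum_i P i * P i -> cscal c%:C + x = \sum_i Q i * Q i ->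
  nle x c.
Proof.
move=> c0 sx sP sQ hP hQ.
have [t tx st] := selfadjoint_lift sx.
have sval (a : linf) n : star a = a -> star (sub_val a n : A) = sub_val a n.
  by move=> sa; rewrite -[in RHS]sa.
have key (y : linf) (F : I -> Ainfty A) : star y = y -> (forall i, star (F i) = F i) ->
    eta y = \sum_i F i * F i -> forall e : R, 0 < e -> exists N, forall n, (N <= n)%N ->
    pos (e%:C%:A + (sub_val y n : A)).
  move=> sy sF yF e e0.
  have /choice[f fP] : forall i, exists a, eta a = F i /\ star a = a.
    by move=> i; have [a] := selfadjoint_lift (sF i); exists a.
  have : eta y = eta (\sum_i f i * f i).
    by rewrite yF eta_sum; apply: eq_bigr => i _; rewrite etaM (fP i).1.
  move=> /eta_eqP /(_ e e0)[N hN]; exists N => n /hN; rewrite sub_val_sum_at.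
  set S := \sum_i _ => yS.
  have pS : pos S.
    apply: pos_sum => i; rewrite sub_valM mulrfctE.
    by apply: pos_sq; exact: sval (fP i).2.
  (* At this index y is within e of the sum of squares S, so e + y is the sum of the positive
     elements e + (y - S) and S. *)
  rewrite -[sub_val y n](subrK S) addrA; apply: posD => //.
  apply: pos_real_add => //; by rewrite starD starN pS.1 sval.
rewrite -tx; apply: nle_lift => e e0.
have sc : star (cscal c%:C : linf) = cscal c%:C.
  by rewrite star_cscal; congr (cscal _); exact: conjc_real.
have [||N hN] := key (cscal c%:C - t) P _ sP _ e e0.
- by rewrite starD starN st sc.
- by rewrite etaD etaN -hP -tx.
have [||M hM] := key (cscal c%:C + t) Q _ sQ _ e e0.
- by rewrite starD st sc.
- by rewrite etaD -hQ -tx.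
exists (maxn N M) => n; rewrite geq_max => /andP[/hN h1 /hM h2].
apply: nrm_le_pos; first by rewrite addr_ge0 // ltW.
- exact: sval.
- rewrite rmorphD scalerDl [_ + e%:C%:A]addrC -addrA; exact: h1.
- rewrite rmorphD scalerDl [_ + e%:C%:A]addrC -addrA; exact: h2.
Qed.

End AsymptoticNorm.

(** * Partitions of unity *)

Section PartitionEstimate.
Variables (R : realType) (G : topGroupType) (A : cstarAlg R).
Variables (alpha : cstarAction G A) (D : cstarSubAlg A).
Variable Phi : sub_alg (cont_fun R G) -> Ainfty A.
Hypothesis D1 : csub_set D 1.
Hypothesis rPhi : rokhlin_map alpha D Phi.

Let CG := sub_alg (cont_fun R G).

Lemma csub_closed_unital : closed_unital_subalg D.
Proof.
split=> //; [|exact: csubD|exact: csubZ|exact: csubM].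
by move=> u l; exact: (@closed_ncvg _ _ D u l (@csub_closed _ _ D)).
Qed.

Lemma Phi0 : Phi 0 = 0.
Proof. by apply: (addrI (Phi 0)); rewrite -(starhomD (rm_hom rPhi)) !addr0. Qed.

Lemma Phi_sum (I : Type) (s : seq I) (F : I -> CG) :
  Phi (\sum_(i <- s) F i) = \sum_(i <- s) Phi (F i).
Proof.
by apply: (big_morph Phi); [exact: (starhomD (rm_hom rPhi))|exact: Phi0].
Qed.

(** The roots s_i of c + d - b_i stay in [D], so they commute with Phi(w_i), and Phi(w_i^2) s_i^2 is
    the square of the self-adjoint element Phi(w_i) s_i; likewise for c + d + b_i. The slack [d] is
    removed by [nle_approx]. *)
Lemma partition_nle_sa (I : finType) (w : I -> CG) (b : I -> A) (c : R) :
  0 <= c -> (forall i, star (w i) = w i) -> \sum_i w i * w i = 1 ->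
  (forall i, csub_set D (b i)) -> (forall i, star (b i) = b i) ->
  (forall i, nrm (b i) <= c) ->
  nle (\sum_i Phi (w i * w i) * const_Ainfty (b i)) c.
Proof.
move=> c0 sw w1 bD sb bc; apply: nle_approx => d d0.
have hP := rm_hom rPhi.
have sPw i : star (Phi (w i)) = Phi (w i) by rewrite -(starhom_star hP) sw.
have sPww i : star (Phi (w i * w i)) = Phi (w i * w i).
  by rewrite -(starhom_star hP) starM sw.
have root (b' : I -> A) : (forall i, csub_set D (b' i)) -> (forall i, pos (b' i)) ->
    exists s : I -> A, forall i,
      [/\ star (s i) = s i, s i * s i = b' i + d%:C%:A & csub_set D (s i)].
  move=> bD' pb.
  have /choice[s sP] : forall i, exists s : A,
      [/\ star s = s, s * s = b' i + d%:C%:A & csub_set D s].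
    move=> i; have [s [s1 s2 s3]] := pos_sqrt (pb i) d0.
    by exists s; split=> //; apply: s3 => //; exact: csub_closed_unital.
  by exists s.
have sq (s : I -> A) i : star (s i) = s i -> csub_set D (s i) ->
    star (Phi (w i) * const_Ainfty (s i)) = Phi (w i) * const_Ainfty (s i) /\
    (Phi (w i) * const_Ainfty (s i)) * (Phi (w i) * const_Ainfty (s i)) =
      Phi (w i * w i) * const_Ainfty (s i * s i).
  move=> ss sD; split.
    by rewrite starM sPw -const_Ainfty_star ss (rm_com rPhi).
  rewrite mulrA -(mulrA (Phi _)) -(rm_com rPhi) // !mulrA -mulrA.
  by rewrite -const_AinftyM -(starhomM hP).
have csum (k : R[i]) : \sum_i Phi (w i * w i) * const_Ainfty (k%:A) = cscal k.
  rewrite -mulr_suml -Phi_sum w1 (starhom1 hP) mul1r.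
  exact: const_Ainfty_cscal.
have Dreal (r : R) : csub_set D r%:C%:A by apply: csubZ.
have pm i : pos (c%:C%:A - b i) by exact: pos_real_sub.
have pp i : pos (c%:C%:A + b i) by exact: pos_real_add.
have [i|s sP] := root (fun i => c%:C%:A - b i) _ pm.
  by apply: cusB => //; exact: csub_closed_unital.
have [i|t tP] := root (fun i => c%:C%:A + b i) _ pp; first exact: csubD.
apply: (@nle_sum_sq _ _ I _ _ (fun i => Phi (w i) * const_Ainfty (s i))
  (fun i => Phi (w i) * const_Ainfty (t i))).
- by rewrite addr_ge0 // ltW.
- rewrite star_sum; apply: eq_bigr => i _.
  by rewrite starM sPww -const_Ainfty_star sb (rm_com rPhi).
- by move=> i; have [s1 _ s3] := sP i; exact: (sq s i s1 s3).1.
- by move=> i; have [s1 _ s3] := tP i; exact: (sq t i s1 s3).1.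
- rewrite -csum -sumrB; apply: eq_bigr => i _.
  have [s1 s2 s3] := sP i; rewrite (sq s i s1 s3).2 s2 -mulrBr.
  rewrite -const_AinftyN -const_AinftyD; congr (_ * const_Ainfty _).
  by rewrite rmorphD scalerDl addrAC.
- rewrite -csum -big_split; apply: eq_bigr => i _.
  have [s1 s2 s3] := tP i; rewrite (sq t i s1 s3).2 s2 /= -mulrDr.
  rewrite -const_AinftyD; congr (_ * const_Ainfty _).
  by rewrite rmorphD scalerDl addrAC.
Qed.

(** Real and imaginary parts are bounded by [c] each. The alternative [w i = 0] is meant for
    products of two partitions, where a coefficient is controlled only if the supports meet. *)
Lemma partition_nle (I : finType) (w : I -> CG) (b : I -> A) (c : R) :
  0 <= c -> (forall i, star (w i) = w i) -> \sum_i w i * w i = 1 ->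
  (forall i, csub_set D (b i)) -> (forall i, w i = 0 \/ nrm (b i) <= c) ->
  nle (\sum_i Phi (w i * w i) * const_Ainfty (b i)) (c + c).
Proof.
move=> c0 sw w1 bD bc.
wlog bc' : b bD bc / forall i, nrm (b i) <= c.
  (* Coefficients at vanishing [w i] do not affect the sum and are reset to 0. *)
  move=> H; pose b' i := if w i == 0 then 0 else b i.
  have -> : \sum_i Phi (w i * w i) * const_Ainfty (b i) =
            \sum_i Phi (w i * w i) * const_Ainfty (b' i).
    apply: eq_bigr => i _; rewrite /b'; case: eqP => // ->.
    by rewrite mul0r Phi0 !mul0r.
  have b'c i : nrm (b' i) <= c.
    by rewrite /b'; case: eqP => [_|w0]; [rewrite nrm0|case: (bc i)].
  apply: H => // i; last by right.
  by rewrite /b'; case: eqP => // _; exact: csub0.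
pose re (x : A) : A := (2^-1)%:C *: (x + star x).
pose im (x : A) : A := (2^-1)%:C *: ('i%C *: (star x - x)).
have hh : (2^-1)%:C + (2^-1)%:C = 1 :> R[i].
  by rewrite -rmorphD /= (_ : 2^-1 + 2^-1 = 1 :> R) //; lra.
have reim x : x = re x + 'i%C *: im x.
  have -> : 'i%C *: im x = (2^-1)%:C *: (x - star x).
    rewrite /im !scalerA mulrAC -expr2 sqr_i mulN1r scaleNr -scalerN.
    by rewrite opprB.
  by rewrite /re -scalerDr addrACA subrr addr0 scalerDr -scalerDl hh scale1r.
have h2 : `|2^-1| = 2^-1 :> R by rewrite ger0_norm // invr_ge0.
have re_le x : nrm (re x) <= nrm x.
  by rewrite nrmZ h2; have := nrmD x (star x); rewrite nrm_star; lra.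
have im_le x : nrm (im x) <= nrm x.
  by rewrite nrmZ nrmZi h2; have := nrmB (star x) x; rewrite nrm_star; lra.
have sre x : star (re x) = re x by rewrite starZr starD starK addrC.
have sim x : star (im x) = im x.
  rewrite starZr starZ starD starN starK; congr (_ *: _).
  by rewrite [X in X *: _]conj_i scaleNr -scalerN opprB.
have reD x : csub_set D x -> csub_set D (re x).
  by move=> Dx; apply: csubZ; apply: csubD => //; exact: csub_star.
have imD x : csub_set D x -> csub_set D (im x).
  move=> Dx; do 2!apply: csubZ; apply: (cusB csub_closed_unital) => //.
  exact: csub_star.
have -> : \sum_i Phi (w i * w i) * const_Ainfty (b i) =
    \sum_i Phi (w i * w i) * const_Ainfty (re (b i)) +
    cscal 'i%C * \sum_i Phi (w i * w i) * const_Ainfty (im (b i)).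
  rewrite mulr_sumr -big_split; apply: eq_bigr => i _.
  rewrite {1}[b i]reim const_AinftyD (const_AinftyZ 'i%C) mulrDr /=.
  by congr (_ + _); rewrite !mulrA -cscalC.
apply: nleD; last apply: nle_scali.
  apply: partition_nle_sa => // i; [exact: reD|exact: le_trans (re_le _) (bc' i)].
apply: partition_nle_sa => // i; [exact: imD|exact: le_trans (im_le _) (bc' i)].
Qed.

End PartitionEstimate.

Section PartitionOfUnity.
Variables (R : realType) (G : topGroupType) (A : cstarAlg R).
Variable alpha : cstarAction G A.

Lemma cont_fun_real (u : G -> R) : continuous u ->
  sub_set (cont_fun R G) (fun g => (u g)%:C).
Proof.
move=> cu; rewrite /sub_set /= => g; apply/(@cvgrPdist_le _ R[i]^o) => _ /lt0c[e e0 ->].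
have /cvgrPdist_le /(_ e e0) := cu g.
apply: filterS => h; rewrite -rmorphB normc_def /= expr0n addr0 sqrtr_sqr.
by rewrite lecR.
Qed.

Lemma continuous_action_dist x y : continuous (fun g => nrm (alpha g x - y)).
Proof.
move=> g; apply/cvgrPdist_le => e e0; have := action_near alpha x g e0.
apply: filterS => h he; rewrite ler_norml.
have := nrm_dist (alpha h x) (alpha g x) y.
have := nrm_dist (alpha g x) (alpha h x) y.
by rewrite [nrm (alpha g x - alpha h x)]nrmBC; lra.
Qed.

Lemma continuous_fin_sum (J : Type) (s : seq J) (F : J -> G -> R) :
  (forall j, continuous (F j)) -> continuous (fun g => \sum_(j <- s) F j g).
Proof.
move=> cF g; elim: s => [|j s IH].
  by under eq_fun do rewrite big_nil; exact: cvg_cst.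
under eq_fun do rewrite big_cons.
by apply: cvgD => //; exact: cF.
Qed.

(* The bump functions are cut out of the distances along the orbit of [v], so no
   Urysohn lemma is needed. *)
Lemma partition_of_unity (J : finType) (v : J -> A) (e : R) :
  compact [set: G] -> 0 < e ->
  exists N (g : 'I_N -> G) (w : 'I_N -> sub_alg (cont_fun R G)),
    [/\ forall i, star (w i) = w i, \sum_i w i * w i = 1 &
        forall i h, sub_val (w i) h != 0 ->
          forall j, nrm (alpha h (v j) - alpha (g i) (v j)) <= e].
Proof.
move=> cG e0.
(* Summing over [j] lets one bump function control all the elements [v j] at once. *)
pose d h g := \sum_j nrm (alpha h (v j) - alpha g (v j)).
have cd g : continuous (d^~ g).
  by apply: continuous_fin_sum => j; exact: continuous_action_dist.
have [s sP] : exists s : seq G, forall h, exists2 g, g \in s & d h g < e.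
  apply: compact_net => // g; have /cvgrPdist_lt /(_ e e0) := cd g g.
  apply: filterS => h; rewrite [d g g]big1 ?sub0r ?normrN => [/ltr_normlW //|j _].
  by rewrite subrr nrm0.
pose g (i : 'I_(size s)) := nth 1%g s i.
(* Twice the positive part of [e - d h (g i)]. *)
pose f i h := e - d h (g i) + `|e - d h (g i)|.
have f0 i h : 0 <= f i h.
  by rewrite /f; have := ler_norm (- (e - d h (g i))); rewrite normrN; lra.
have fd i h : f i h != 0 -> d h (g i) < e.
  move=> fi; rewrite ltNge; apply: contra fi => de.
  by rewrite /f ler0_norm ?subrr // subr_le0.
pose S h := \sum_i f i h * f i h.
have S0 h : 0 < S h.
  have [x xs dx] := sP h.
  have xi : (index x s < size s)%N by rewrite index_mem.
  rewrite /S (bigD1 (Ordinal xi)) //= ltr_pwDl //.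
    have fx : 0 < f (Ordinal xi) h.
      by rewrite /f /g /= nth_index // ltr_pwDl ?normr_ge0 ?subr_gt0.
    exact: mulr_gt0.
  by apply: sumr_ge0 => i _; rewrite mulr_ge0.
have cf i : continuous (f i).
  move=> h; apply: cvgD; last apply: cvg_norm; apply: cvgB; try exact: cvg_cst;
    exact: cd.
have cS : continuous S.
  by apply: continuous_fin_sum => i h; apply: cvgM; exact: cf.
pose u i h := f i h / Num.sqrt (S h).
have cu i : continuous (u i).
  move=> h; apply: cvgM; first exact: cf.
  apply: cvgV; first by rewrite sqrtr_eq0 -ltNge.
  by apply: (@continuous_comp _ _ _ S Num.sqrt); [exact: cS|exact: sqrt_continuous].
pose w i := to_sub (cont_fun_real (cu i)) : sub_alg (cont_fun R G).
exists (size s), g, w; split.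
- move=> i; apply: val_inj; apply/funext => h /=; exact: conjc_real.
- apply: val_inj; rewrite rmorph_sum /=; apply/funext => h.
  rewrite fct_sumE.
  transitivity (\sum_i (u i h * u i h)%:C).
    by apply: eq_bigr => i _; rewrite rmorphM.
  rewrite -rmorph_sum /=.
  have -> : \sum_i u i h * u i h = 1.
    rewrite -(divff (lt0r_neq0 (S0 h))) /S mulr_suml; apply: eq_bigr => i _.
    rewrite /u mulrACA -invfM; congr (_ / _).
    by rewrite -expr2 sqr_sqrtr // ltW.
  by [].
move=> i h wih j; have /fd dh : f i h != 0.
  by apply: contra wih => /eqP fi; rewrite /= /u fi mul0r.
rewrite ltW // (le_lt_trans _ dh) // /d (bigD1 j) //= lerDl.
by apply: sumr_ge0 => k _; exact: nrm_ge0.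
Qed.

End PartitionOfUnity.

Lemma eventually_forall (J : finType) (P : J -> nat -> Prop) :
  (forall j, exists N, forall k, (N <= k)%N -> P j k) ->
  exists N, forall k, (N <= k)%N -> forall j, P j k.
Proof.
move=> /choice[N hN]; exists (\max_j N j) => k Nk j; apply: hN.
by apply: leq_trans Nk; exact: leq_bigmax.
Qed.

Section Translation.
Variables (R : realType) (G : topGroupType).
Notation CG := (sub_alg (cont_fun R G)).
Implicit Types (f : CG).

Lemma cont_fun_ext f f' : (forall h, sub_val f h = sub_val f' h) -> f = f'.
Proof. by move=> ff'; apply: val_inj; apply/funext. Qed.

Lemma cont_funC f f' : f * f' = f' * f.
Proof. by apply: cont_fun_ext => h; rewrite /= !mulrfctE mulrC. Qed.

Lemma LtM g f f' : Lt g (f * f') = Lt g f * Lt g f'.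
Proof. exact: cont_fun_ext. Qed.

Lemma Lt_star g f : Lt g (star f) = star (Lt g f).
Proof. exact: cont_fun_ext. Qed.

Lemma Lt_sum g (I : Type) (s : seq I) (F : I -> CG) :
  Lt g (\sum_(i <- s) F i) = \sum_(i <- s) Lt g (F i).
Proof. by apply: (big_morph (Lt g)) => [f f'|]; exact: cont_fun_ext. Qed.

Lemma Lt1 g : Lt g 1 = 1 :> CG.
Proof. exact: cont_fun_ext. Qed.

Lemma sum_sq_prod (I J : finType) (w : I -> CG) (u : J -> CG) :
  \sum_i w i * w i = 1 -> \sum_j u j * u j = 1 ->
  \sum_(ij : I * J) (w ij.1 * u ij.2) * (w ij.1 * u ij.2) = 1.
Proof.
move=> w1 u1; transitivity (\sum_i \sum_j w i * w i * (u j * u j)).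
  rewrite pair_bigA; apply: eq_bigr => -[i j] _ /=.
  by rewrite -!mulrA; congr (_ * _); rewrite !mulrA (cont_funC (u j)).
by rewrite -w1; apply: eq_bigr => i _; rewrite -mulr_sumr u1 mulr1.
Qed.

End Translation.

(** * From pointwise to uniform estimates over the group *)

Section Equicontinuity.
Variables (R : realType) (G : topGroupType) (A : cstarAlg R).
Variable alpha : cstarAction G A.
Hypothesis cG : compact [set: G].
Notation linf := (sub_alg (linfty A)).

Definition equicontinuous_along (a : linf) := forall g (e : R), 0 < e ->
  \forall h \near g, forall k,
    nrm (alpha h (sub_val a k) - alpha g (sub_val a k)) <= e.

Lemma equicontinuous_sum (I : Type) (s : seq I) (F : I -> linf) :
  (forall i, equicontinuous_along (F i)) ->
  equicontinuous_along (\sum_(i <- s) F i).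
Proof.
move=> hF; elim: s => [|i s IH] g e e0.
  rewrite big_nil; near=> h => k; rewrite -[sub_val 0 k]/(0 : A) !action0 subrr.
  by rewrite nrm0 ltW.
have := IH g _ (halfr_gt0 e0); have := hF i g _ (halfr_gt0 e0).
apply: filterS2 => h h1 h2 k; rewrite big_cons sub_valD.
rewrite -[(_ + _) k]/((sub_val (F i) k : A) + sub_val (\sum_(j <- s) F j) k).
rewrite !actionD opprD addrACA (le_trans (nrmD _ _)) //.
have := h1 k; have := h2 k; lra.
Unshelve. all: by end_near. Qed.

Lemma equicontinuous_constM (d : A) (c a : linf) : (forall k, sub_val c k = d) ->
  equicontinuous_along a -> equicontinuous_along (c * a).
Proof.
move=> cd ea g e e0; have /linfty_nrmP[M aM] := sub_algP a.
have K0 : 0 < `|M| + 1 by rewrite ltr_wpDl.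
have L0 : 0 < nrm d + 1 by rewrite ltr_wpDl ?nrm_ge0.
have := ea g _ (divr_gt0 (halfr_gt0 e0) L0).
have := action_near alpha d g (divr_gt0 (halfr_gt0 e0) K0).
apply: filterS2 => h h1 h2 k; rewrite sub_valM mulrfctE cd !actionMx.
have -> (x y z t : A) : x * y - z * t = (x - z) * y + z * (y - t).
  by rewrite mulrBl mulrBr addrA subrK.
apply: (le_trans (nrmD _ _)).
apply: (le_trans (lerD (nrmM _ _) (nrmM _ _))); rewrite [leRHS]splitr.
have {}h2 := h2 k; rewrite ler_pdivlMr // in h1; rewrite ler_pdivlMr // in h2.
apply: lerD.
  apply: le_trans h1; apply: ler_wpM2l; first exact: nrm_ge0.
  by rewrite action_nrm (le_trans (aM k)) // (le_trans (ler_norm M)) // lerDl.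
rewrite mulrC; apply: le_trans h2; apply: ler_wpM2l; first exact: nrm_ge0.
by rewrite action_nrm lerDl.
Qed.

(* A finite net in the group turns the pointwise estimate on the orbit of the
   class of [a] into one at a single index that is uniform over the group. *)
Lemma osc_le_eventually (a : linf) (c e : R) : 0 < e -> equicontinuous_along a ->
  (forall g, nle (eta (act_linfty alpha g a) - eta a) c) ->
  exists N, forall k, (N <= k)%N -> osc_le alpha (sub_val a k) (c + e).
Proof.
move=> e0 ea ha.
have [s sP] := compact_net cG (fun g => ea g _ (halfr_gt0 e0)).
have ev (i : 'I_(size s)) : exists N, forall k, (N <= k)%N ->
    nrm (alpha (nth 1%g s i) (sub_val a k) - sub_val a k) <= c + e / 2.
  have := ha (nth 1%g s i); rewrite -etaN -etaD.
  move=> /(_ _ erefl _ (halfr_gt0 e0))[N hN]; exists N => k /hN.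
  by rewrite sub_valD -act_linftyE.
have [N hN] := eventually_forall ev; exists N => k Nk g.
have [h hs hg] := sP g; have hi : (index h s < size s)%N by rewrite index_mem.
have := hN k Nk (Ordinal hi); rewrite /= nth_index // => hk.
rewrite (le_trans (nrm_dist _ (alpha h (sub_val a k)) _)) //.
by have := hg k; lra.
Qed.

End Equicontinuity.

(** * Almost invariant partial isometries *)

Section ActionLinfty.
Variables (R : realType) (G : topGroupType) (A : cstarAlg R).
Variable alpha : cstarAction G A.
Notation linf := (sub_alg (linfty A)).

Lemma linf_ext (a b : linf) : (forall k, sub_val a k = sub_val b k) -> a = b.
Proof. by move=> ab; apply: val_inj; apply/funext. Qed.

Lemma cst_bounded (d : A) : sub_set (linfty A) (fun=> d).
Proof. by apply/linfty_nrmP; exists (nrm d). Qed.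

Definition cst_linf (d : A) : linf := to_sub (cst_bounded d).

Lemma eta_cst d : eta (cst_linf d) = const_Ainfty d.
Proof. exact: const_eta. Qed.

Lemma act_linftyM g : {morph act_linfty alpha g : a b / a * b}.
Proof.
move=> a b; apply: linf_ext => k.
by rewrite act_linftyE sub_valM mulrfctE actionMx sub_valM mulrfctE !act_linftyE.
Qed.

Lemma act_linfty_sum g (I : Type) (s : seq I) (F : I -> linf) :
  act_linfty alpha g (\sum_(i <- s) F i) = \sum_(i <- s) act_linfty alpha g (F i).
Proof.
apply: (big_morph (act_linfty alpha g)) => [a b|]; apply: linf_ext => k.
  rewrite act_linftyE -[sub_val (a + b) k]/((sub_val a k : A) + sub_val b k).
  by rewrite actionD -!act_linftyE.
by rewrite act_linftyE action0.
Qed.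

Lemma act_linfty_cst g d : act_linfty alpha g (cst_linf d) = cst_linf (alpha g d).
Proof. by apply: linf_ext => k; rewrite act_linftyE. Qed.

End ActionLinfty.

(** * Gluing the orbit of [v] along a partition of unity *)

Section LocalisedPartition.
Variables (R : realType) (G : topGroupType) (A : cstarAlg R).
Variables (alpha : cstarAction G A) (D : cstarSubAlg A).
Variable Phi : sub_alg (cont_fun R G) -> Ainfty A.
Hypothesis D1 : csub_set D 1.
Hypothesis invD : invariant_sub alpha D.
Hypothesis rPhi : rokhlin_map alpha D Phi.
Notation linf := (sub_alg (linfty A)).
Notation CG := (sub_alg (cont_fun R G)).

Variables (m n : nat) (v : 'M[A]_(n, m)) (e : R).
Hypothesis e0 : 0 < e.
Hypothesis vD : forall l j, csub_set D (v l j).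
Variables (I : finType) (gi : I -> G) (w : I -> CG).
Hypothesis sw : forall i, star (w i) = w i.
Hypothesis w1 : \sum_i w i * w i = 1.
Hypothesis wloc : forall i h, sub_val (w i) h != 0 ->
  forall l j, nrm (alpha h (v l j) - alpha (gi i) (v l j)) <= e.

(* The image of [v] under the map [A -> (A^alpha)_oo] that one would get from
   [C(G, A)], with the orbit map [g |-> alpha_g v] replaced by a step function. *)
Definition spread l j : Ainfty A :=
  \sum_i const_Ainfty (alpha (gi i) (v l j)) * Phi (w i * w i).

Let hP := rm_hom rPhi.

Lemma spread_comm l j :
  spread l j = \sum_i Phi (w i * w i) * const_Ainfty (alpha (gi i) (v l j)).
Proof.
by apply: eq_bigr => i _; rewrite (rm_com rPhi) //; apply: invD.
Qed.

Lemma nle_spread l j : nle (spread l j) (nrm (v l j) + nrm (v l j)).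
Proof.
rewrite spread_comm; apply: (partition_nle D1 rPhi) => // [|i|i].
- exact: nrm_ge0.
- exact: invD.
- by right; rewrite action_nrm.
Qed.

(** Multiplying by a second family that sums to 1 brings sums over different partitions to a common
    index set. *)
Lemma Phi_double_sum (I1 I2 : finType) (f1 : I1 -> CG) (f2 : I2 -> CG)
    (b : I1 -> Ainfty A) : \sum_i f2 i = 1 ->
  \sum_(ij : I1 * I2) Phi (f1 ij.1 * f2 ij.2) * b ij.1 = \sum_i Phi (f1 i) * b i.
Proof.
move=> f21; rewrite -(pair_bigA _ (fun i j => Phi (f1 i * f2 j) * b i)) /=.
apply: eq_bigr => i _; rewrite -mulr_suml; congr (_ * _).
by rewrite -(Phi_sum rPhi) -mulr_sumr f21 mulr1.
Qed.

Lemma Phi_double_sum_r (I1 I2 : finType) (f1 : I1 -> CG) (f2 : I2 -> CG)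
    (b : I2 -> Ainfty A) : \sum_i f1 i = 1 ->
  \sum_(ij : I1 * I2) Phi (f1 ij.1 * f2 ij.2) * b ij.2 = \sum_i Phi (f2 i) * b i.
Proof.
move=> f11; rewrite -(pair_bigA _ (fun i j => Phi (f1 i * f2 j) * b j)) /=.
rewrite exchange_big; apply: eq_bigr => j _; rewrite -mulr_suml; congr (_ * _).
by rewrite -(Phi_sum rPhi) -mulr_suml f11 mul1r.
Qed.

Lemma sq_prod (f f' : CG) : (f * f') * (f * f') = (f * f) * (f' * f').
Proof. by rewrite -!mulrA; congr (_ * _); rewrite !mulrA (cont_funC f'). Qed.

(** Over the product of the translated partition with [w], the coefficients are
    alpha_g(alpha_{g_i}(v)) - alpha_{g_i'}(v). Where the product is nonzero there is a k with g^-1 k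
    in the support of w_i and k in that of w_i', so both terms are within [e] of alpha_k(v).
    [partition_nle] doubles the resulting 2 e. *)
Lemma spread_invariant g l j (a : linf) : eta a = spread l j ->
  nle (eta (act_linfty alpha g a) - eta a) (e + e + (e + e)).
Proof.
move=> ha.
have /choice[b bP] : forall i, exists b, eta b = Phi (w i * w i).
  by move=> i; have [b _ hb] := rm_lift rPhi (w i * w i); exists b.
pose T : linf := \sum_i cst_linf (alpha (gi i) (v l j)) * b i.
have Ta : eta a = eta T.
  rewrite ha /T eta_sum; apply: eq_bigr => i _.
  by rewrite etaM eta_cst bP.
rewrite (act_linfty_eta alpha g Ta) /T act_linfty_sum eta_sum ha spread_comm.
have vD' i : csub_set D (alpha (gi i) (v l j)) by exact: invD.
have vD'' i : csub_set D (alpha g (alpha (gi i) (v l j))) by exact: invD.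
pose c i := const_Ainfty (alpha (gi i) (v l j)).
pose c' i := const_Ainfty (alpha g (alpha (gi i) (v l j))).
have wg1 : \sum_i Lt g (w i) * Lt g (w i) = 1.
  by under eq_bigr do rewrite -LtM; rewrite -Lt_sum w1 Lt1.
have -> : \sum_i eta (act_linfty alpha g (cst_linf (alpha (gi i) (v l j)) * b i)) =
    \sum_i Phi (Lt g (w i) * Lt g (w i)) * c' i.
  apply: eq_bigr => i _; rewrite act_linftyM etaM act_linfty_cst eta_cst.
  by rewrite (rm_equiv rPhi _ (bP i)) LtM -(rm_com rPhi).
rewrite -(Phi_double_sum (fun i => Lt g (w i) * Lt g (w i)) c' w1).
rewrite -(Phi_double_sum_r (fun i => w i * w i) c wg1) -sumrB.
under eq_bigr => ij _ do
  rewrite -mulrBr -const_AinftyN -const_AinftyD -sq_prod.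
apply: (partition_nle D1 rPhi) => //.
- by rewrite addr_ge0 // ltW.
- by move=> [i i'] /=; rewrite starM -Lt_star !sw cont_funC.
- exact: (@sum_sq_prod _ _ _ _ (fun i => Lt g (w i)) w wg1 w1).
- by move=> [i i'] /=; apply: cusB (csub_closed_unital D1) _ _.
move=> [i i'] /=.
have [W0|W0] := eqVneq (Lt g (w i) * w i') 0; [by left|right].
have [k] : exists k, sub_val (w i) (g^-1 * k)%g != 0 /\ sub_val (w i') k != 0.
  apply: contrapT => /forallNP H; move/eqP: W0; apply.
  apply: cont_fun_ext => k; rewrite /= mulrfctE /=.
  by have /not_andP[/negP/negPn/eqP ->|/negP/negPn/eqP ->] := H k;
    rewrite ?mul0r ?mulr0.
move=> [/wloc/(_ l j) h1 /wloc/(_ l j) h2].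
rewrite (le_trans (nrm_dist _ (alpha k (v l j)) _)) // lerD //.
by rewrite nrmBC -(action_nrm alpha g^-1%g) actionB actionKV -actionM.
Qed.

(** As p is fixed, p = alpha_{g_i}(v)^* alpha_{g_i}(v) for every i. The defect is thus a double sum
    with coefficients alpha_{g_i}(v)^* (alpha_{g_i'}(v) - alpha_{g_i}(v)), and the second factor is
    at most 2 e entrywise where the supports meet. *)
Lemma spread_isometry (p : 'M[A]_m) : star_mx v *m v = p ->
  (forall g j k, alpha g (p j k) = p j k) ->
  forall j k, nle (\sum_l star (spread l j) * spread l k - const_Ainfty (p j k))
    (mnrm v * (e + e) + mnrm v * (e + e)).
Proof.
move=> vp pfix j k.
pose c l i := const_Ainfty (alpha (gi i) (v l k)).
pose cs l i := const_Ainfty (star (alpha (gi i) (v l j))).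
have spr l : star (spread l j) * spread l k =
    \sum_(ii : I * I) Phi ((w ii.1 * w ii.1) * (w ii.2 * w ii.2)) *
      (cs l ii.1 * c l ii.2).
  rewrite (spread_comm l j) (spread_comm l k) star_sum mulr_suml.
  rewrite -(pair_bigA _ (fun i i' => Phi ((w i * w i) * (w i' * w i')) *
      (cs l i * c l i'))) /=.
  apply: eq_bigr => i _; rewrite mulr_sumr; apply: eq_bigr => i' _.
  have sD : csub_set D (star (alpha (gi i) (v l j))) by apply: csub_star; exact: invD.
  have h f : cs l i * Phi f = Phi f * cs l i by rewrite (rm_com rPhi).
  rewrite starM -(starhom_star hP) starM sw -const_Ainfty_star -/(cs l i) -/(c l i').
  rewrite (starhomM hP (w i * w i)) h -!mulrA; congr (_ * _).
  by rewrite [LHS]mulrA h mulrA.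
have pE i : p j k = \sum_l star (alpha (gi i) (v l j)) * alpha (gi i) (v l k).
  rewrite -(pfix (gi i)) -vp mxE action_sum; apply: eq_bigr => l _.
  by rewrite mxE actionMx action_star.
pose b (ii : I * I) := \sum_l
  star (alpha (gi ii.1) (v l j)) * (alpha (gi ii.2) (v l k) - alpha (gi ii.1) (v l k)).
have -> : \sum_l star (spread l j) * spread l k - const_Ainfty (p j k) =
    \sum_(ii : I * I) Phi ((w ii.1 * w ii.2) * (w ii.1 * w ii.2)) * const_Ainfty (b ii).
  have -> : const_Ainfty (p j k) = \sum_(ii : I * I)
      Phi ((w ii.1 * w ii.1) * (w ii.2 * w ii.2)) * const_Ainfty (p j k).
    rewrite (Phi_double_sum_r (fun i => w i * w i) (fun=> const_Ainfty (p j k)) w1).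
    by rewrite -mulr_suml -(Phi_sum rPhi) w1 (starhom1 hP) mul1r.
  under eq_bigr do rewrite spr.
  rewrite exchange_big -sumrB; apply: eq_bigr => -[i i'] _ /=.
  rewrite -mulr_sumr -mulrBr sq_prod; congr (_ * _); rewrite (pE i) /b /=.
  rewrite !const_Ainfty_sum -sumrB; apply: eq_bigr => l _.
  by rewrite -const_AinftyM -const_AinftyN -const_AinftyD mulrBr.
apply: (partition_nle D1 rPhi) => //.
- by rewrite mulr_ge0 ?mnrm_ge0 // addr_ge0 // ltW.
- by move=> [i i'] /=; rewrite starM !sw cont_funC.
- exact: (@sum_sq_prod _ _ _ _ w w w1 w1).
- move=> [i i']; apply: cus_sum; first exact: csub_closed_unital.
  move=> l /=; apply: csubM; first by apply: csub_star; exact: invD.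
  by apply: cusB (csub_closed_unital D1) _ _; exact: invD.
move=> [i i'] /=.
have [W0|W0] := eqVneq (w i * w i') 0; [by left|right].
have [h] : exists h, sub_val (w i) h != 0 /\ sub_val (w i') h != 0.
  apply: contrapT => /forallNP H; move/eqP: W0; apply.
  apply: cont_fun_ext => h; rewrite /= mulrfctE /=.
  by have /not_andP[/negP/negPn/eqP ->|/negP/negPn/eqP ->] := H h;
    rewrite ?mul0r ?mulr0.
move=> [/wloc h1 /wloc h2].
rewrite /b (le_trans (nrm_sum _ _ _)) //= /mnrm mulr_suml; apply: ler_sum => l _.
apply: (le_trans (nrmM _ _)); rewrite nrm_star action_nrm.
apply: ler_pM; [exact: nrm_ge0|exact: nrm_ge0| |].
  by rewrite (bigD1 j) //= lerDl; apply: sumr_ge0 => ? _; exact: nrm_ge0.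
rewrite (le_trans (nrm_dist _ (alpha h (v l k)) _)) // lerD //.
by rewrite nrmBC.
Qed.

End LocalisedPartition.

(** * From the sequence algebra back to [A] *)

Section ApproxPartialIsometry.
Variables (R : realType) (G : topGroupType) (A : cstarAlg R).
Variable alpha : cstarAction G A.

Lemma fixed_algP x : sub_set (fixed_alg alpha) x <-> forall g, alpha g x = x.
Proof. by []. Qed.

Lemma fixed_closed_unital : closed_unital_subalg (sub_set (fixed_alg alpha)).
Proof.
split=> //=.
- move=> u l uf ul g; apply: (@ncvg_uniq _ _ (fun k => alpha g (u k))).
    by apply: (@ncvg_lip _ _ _ 1) ul => k; rewrite -actionB action_nrm mul1r.
  by move=> e /ul[N hN]; exists N => k Nk; rewrite uf; exact: hN.
- by move=> g; exact: (starhom1 (action_hom alpha g)).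
- by move=> x y fx fy; exact: (subD (s := fixed_alg alpha)).
- by move=> k x fx g; rewrite actionZ fx.
- by move=> x y fx fy; exact: (subM (s := fixed_alg alpha)).
Qed.

(** Each asymptotic bound holds with slack [e] from some index on, and there are finitely many
    entries, so one index [k] serves all; 5 e is the 4 e of [spread_invariant] plus this slack. *)
Lemma almost_invariant_matrix (m n : nat) (v : 'M[A]_(n, m)) (q : 'M[A]_n) (e : R) :
  compact [set: G] -> Rokhlin alpha ->
  (forall g j k, alpha g ((star_mx v *m v) j k) = (star_mx v *m v) j k) ->
  (forall g l l', alpha g (q l l') = q l l') -> q *m v = v -> 0 < e ->
  exists W : 'M[A]_(n, m), [/\ q *m W = W,
    forall l j, osc_le alpha (W l j) (5 * e),
    forall l j, nrm (W l j) <= 2 * mnrm v + e &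
    forall j k, nrm ((star_mx W *m W - star_mx v *m v) j k) <= (4 * mnrm v + 1) * e].
Proof.
move=> cG rok pfix qfix qv e0; set p := star_mx v *m v in pfix *.
have [D [sD invD D1 vD']] := @separable_invariant_subalg _ _ _ alpha _
  (fun lj : 'I_n * 'I_m => v lj.1 lj.2) cG.
have vD l j : csub_set D (v l j) by exact: vD' (l, j).
have [Phi rPhi] := Rokhlin_map rok sD invD D1.
have [N0 [gi [w [sw w1 wloc']]]] := partition_of_unity alpha
  (fun lj : 'I_n * 'I_m => v lj.1 lj.2) cG e0.
have wloc i h : sub_val (w i) h != 0 ->
    forall l j, nrm (alpha h (v l j) - alpha (gi i) (v l j)) <= e.
  by move=> /wloc' H l j; exact: H (l, j).
have /choice[b bP] : forall i, exists b, linfty_cont alpha b /\ eta b = Phi (w i * w i).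
  by move=> i; have [b] := rm_lift rPhi (w i * w i); exists b.
pose T l j : sub_alg (linfty A) := \sum_i cst_linf (alpha (gi i) (v l j)) * b i.
have eT l j : eta (T l j) = spread alpha Phi v gi w l j.
  by rewrite eta_sum; apply: eq_bigr => i _; rewrite etaM eta_cst (bP i).2.
have TE l j k : sub_val (T l j) k =
    \sum_i alpha (gi i) (v l j) * (sub_val (b i) k : A) :> A.
  by rewrite sub_val_sum_at.
have equiT l j : equicontinuous_along alpha (T l j).
  apply: equicontinuous_sum => i.
  apply: (@equicontinuous_constM _ _ _ _ (alpha (gi i) (v l j))) => //.
  by move=> g d d0; exact: linfty_cont_near (bP i).1 d0.
have [N1 hN1] : exists N, forall k, (N <= k)%N -> forall lj : 'I_n * 'I_m,
    osc_le alpha (sub_val (T lj.1 lj.2) k) (e + e + (e + e) + e).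
  apply: (@eventually_forall _
    (fun lj k => osc_le alpha (sub_val (T lj.1 lj.2) k) _)) => lj.
  apply: osc_le_eventually => // g.
  by apply: (spread_invariant D1 invD rPhi e0 vD sw w1 wloc); exact: eT.
have [N2 hN2] : exists N, forall k, (N <= k)%N -> forall lj : 'I_n * 'I_m,
    nrm (sub_val (T lj.1 lj.2) k : A) <= nrm (v lj.1 lj.2) + nrm (v lj.1 lj.2) + e.
  apply: (@eventually_forall _
    (fun lj k => nrm (sub_val (T lj.1 lj.2) k : A) <= _)) => lj.
  have H : nle (spread alpha Phi v gi w lj.1 lj.2)
      (nrm (v lj.1 lj.2) + nrm (v lj.1 lj.2)) by exact: (nle_spread D1 invD).
  exact: H (eT _ _) _ e0.
have [N3 hN3] : exists N, forall k, (N <= k)%N -> forall jk : 'I_m * 'I_m,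
    nrm (\sum_l star (sub_val (T l jk.1) k : A) * sub_val (T l jk.2) k - p jk.1 jk.2)
      <= mnrm v * (e + e) + mnrm v * (e + e) + e.
  apply: (@eventually_forall _ (fun jk k => nrm (\sum_l star (sub_val (T l jk.1) k : A)
    * sub_val (T l jk.2) k - p jk.1 jk.2) <= _)) => -[j j'] /=.
  pose a := \sum_l star (T l j) * T l j' - cst_linf (p j j').
  have H : nle (\sum_l star (spread alpha Phi v gi w l j) * spread alpha Phi v gi w l j'
      - const_Ainfty (p j j')) (mnrm v * (e + e) + mnrm v * (e + e)).
    exact: (spread_isometry D1 invD rPhi e0 vD sw w1 wloc (erefl p) pfix).
  have [|N hN] := H a _ e e0.
    rewrite /a etaD etaN eta_cst eta_sum; congr (_ - _); apply: eq_bigr => l _.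
    by rewrite etaM eta_star !eT.
  exists N => k /hN; rewrite /a sub_valD.
  rewrite -[(_ + _) k]/((sub_val (\sum_l star (T l j) * T l j') k : A) - p j j').
  by rewrite sub_val_sum_at.
pose k := maxn N1 (maxn N2 N3).
have {}hN1 := hN1 k (leq_maxl _ _).
have {}hN2 := hN2 k (leq_trans (leq_maxl _ _) (leq_maxr _ _)).
have {}hN3 := hN3 k (leq_trans (leq_maxr _ _) (leq_maxr _ _)).
exists (\matrix_(l, j) (sub_val (T l j) k : A)); split.
(* Since q is fixed, q alpha_g(v) = alpha_g(q v) = alpha_g(v); with the coefficients on the left in
   [T], the relation is exact at every index. *)
- apply/matrixP => l j; rewrite !mxE TE.
  under eq_bigr do rewrite mxE TE mulr_sumr.
  rewrite exchange_big; apply: eq_bigr => i _.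
  rewrite -[in RHS]qv mxE action_sum mulr_suml; apply: eq_bigr => l' _.
  by rewrite actionMx qfix mulrA.
- move=> l j; rewrite mxE; have -> : 5 * e = e + e + (e + e) + e by ring.
  exact: hN1 (l, j).
- move=> l j; rewrite mxE; apply: (le_trans (hN2 (l, j))) => /=.
  by have := mnrm_entry v l j; lra.
move=> j j'; rewrite !mxE; under eq_bigr do rewrite !mxE.
have := hN3 (j, j'); rewrite /= /p !mxE => h; apply: (le_trans h); lra.
Qed.

Lemma invariant_partial_isometry (m n : nat) (v : 'M[A]_(n, m)) (p : 'M[A]_m)
    (q : 'M[A]_n) :
  compact [set: G] -> Rokhlin alpha ->
  (forall g j k, alpha g (p j k) = p j k) ->
  (forall g l l', alpha g (q l l') = q l l') ->
  is_projection p -> is_projection q -> star_mx v *m v = p -> q *m v = v ->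
  exists w : 'M[A]_(n, m),
    [/\ forall g l j, alpha g (w l j) = w l j, star_mx w *m w = p & q *m w = w].
Proof.
move=> cG rok pfix qfix pp qq vp qv.
(* [K] bounds [mnrm W], using [e <= 1], and [Q * e] bounds the change of q W under averaging. The
   isometry defect is then at most [e * C], and [e] is chosen to meet the threshold 4^-1 of the
   iteration. *)
pose M := mnrm v; pose nm : R := (n * m)%:R.
pose K := nm * (2 * M + 1); pose Q := mnrm q * (nm * 5); pose P := mnrm p.
pose C := P * ((m * m)%:R * (4 * M + 1) + 2 * K * Q + Q * Q) * P.
have M0 : 0 <= M := mnrm_ge0 v; have P0 : 0 <= P := mnrm_ge0 p.
have nm0 : 0 <= nm by rewrite ler0n.
have K0 : 0 <= K by rewrite mulr_ge0 // addr_ge0 // mulr_ge0.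
have Q0 : 0 <= Q by rewrite !mulr_ge0 // mnrm_ge0.
have B0 : 0 <= (m * m)%:R * (4 * M + 1) + 2 * K * Q + Q * Q.
  have M4 : 0 <= 4 * M + 1 by rewrite addr_ge0 // mulr_ge0.
  apply: addr_ge0; last exact: mulr_ge0.
  apply: addr_ge0; first exact: mulr_ge0 (ler0n _ _) M4.
  exact: mulr_ge0 (mulr_ge0 (ler0n _ 2) K0) Q0.
have C0 : 0 <= C by rewrite !mulr_ge0.
pose e := (4 * (C + 1))^-1.
have e0 : 0 < e by rewrite invr_gt0 mulr_gt0 // ltr_wpDl.
have e1 : e <= 1 by rewrite invf_le1 ?mulr_gt0 ?ltr_wpDl //; lra.
have eC : e * C <= 4^-1.
  rewrite /e mulrC ler_pdivrMr ?mulr_gt0 ?ltr_wpDl //; lra.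
rewrite -vp in pfix.
have [W [qW Wosc Wn Wi]] := almost_invariant_matrix cG rok pfix qfix qv e0.
rewrite vp in pfix Wi.
have /choice[y yP] : forall lj : 'I_n * 'I_m, exists y,
    (forall g, alpha g y = y) /\ nrm (y - W lj.1 lj.2) <= 5 * e.
  move=> [l j] /=; have e5 : 0 < 5 * e by lra.
  by have [y] := approx_fixed cG e5 (Wosc l j); exists y.
pose Y := \matrix_(l, j) y (l, j).
have Yfix g l j : alpha g (Y l j) = Y l j by rewrite mxE (yP (l, j)).1.
(* Entrywise averaging need not respect the relations with [p] and [q]; compressing to q Y p
   restores them and keeps the entries fixed. *)
have [||||||w [wfix wp qw]] := @exact_partial_isometry _ _ _ _ p q pp
  (sub_set (fixed_alg alpha)) (q *m Y *m p) fixed_closed_unital.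
- by move=> x fx; exact: sub_star.
- by move=> j k; apply/fixed_algP => g; exact: pfix.
- move=> l j; rewrite mxE; apply: cus_sum fixed_closed_unital _ => a.
  apply: (cusM fixed_closed_unital); last by apply/fixed_algP => g; exact: pfix.
  rewrite mxE; apply: cus_sum fixed_closed_unital _ => c.
  by apply: (cusM fixed_closed_unital); apply/fixed_algP => g; [exact: qfix|exact: Yfix].
- by rewrite -mulmxA pp.1.
- by rewrite !mulmxA qq.1.
- pose d := q *m (Y - W).
  have qY : q *m Y = W + d by rewrite /d mulmxBr qW addrC subrK.
  have -> : p - star_mx (q *m Y *m p) *m (q *m Y *m p) =
      - (p *m (star_mx W *m W - p + (star_mx W *m d + star_mx d *m W)
          + star_mx d *m d) *m p).
    have -> : star_mx W *m W - p + (star_mx W *m d + star_mx d *m W)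
        + star_mx d *m d = star_mx (W + d) *m (W + d) - p.
      rewrite star_mxD mulmxDl !mulmxDr -!addrA; congr (_ + _).
      by rewrite addrC -!addrA.
    by rewrite star_mxM pp.2 qY mulmxBr mulmxBl pp.1 pp.1 opprB !mulmxA.
  have dQ : mnrm d <= Q * e.
    rewrite /d /Q (le_trans (mnrmM _ _)) // -mulrA ler_wpM2l ?mnrm_ge0 //.
    rewrite -mulrA; apply: mnrm_le => l j.
    by rewrite !mxE; exact: (yP (l, j)).2.
  have WK : mnrm W <= K.
    by apply: mnrm_le => l j; apply: (le_trans (Wn l j)); rewrite -/M lerD2l.
  have Wp : mnrm (star_mx W *m W - p) <= (m * m)%:R * ((4 * M + 1) * e).
    by apply: mnrm_le => j k; exact: Wi.
  have d0 := mnrm_ge0 d.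
  have Wd : mnrm (star_mx W *m d) <= K * (Q * e).
    rewrite (le_trans (mnrmM _ _)) // mnrm_star; apply: ler_pM => //.
    exact: mnrm_ge0.
  have dW : mnrm (star_mx d *m W) <= K * (Q * e).
    rewrite (le_trans (mnrmM _ _)) // mnrm_star mulrC; apply: ler_pM => //.
    exact: mnrm_ge0.
  have dd : mnrm (star_mx d *m d) <= Q * (Q * e).
    rewrite (le_trans (mnrmM _ _)) // mnrm_star; apply: ler_pM => //.
    by apply: (le_trans dQ); rewrite ler_piMr.
  rewrite mnrmN; apply: le_trans eC.
  have -> : e * C = P * ((m * m)%:R * ((4 * M + 1) * e) + (K * (Q * e) + K * (Q * e))
      + Q * (Q * e)) * P by rewrite /C; ring.
  apply: (le_trans (mnrmM _ _)); apply: ler_wpM2r => //.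
  apply: (le_trans (mnrmM _ _)); apply: ler_wpM2l => //.
  apply: (le_trans (mnrmD _ _)); apply: lerD => //.
  apply: (le_trans (mnrmD _ _)); apply: lerD => //.
  by apply: (le_trans (mnrmD _ _)); apply: lerD.
by exists w; split=> // g l j; have /fixed_algP := wfix l j; exact.
Qed.

End ApproxPartialIsometry.

(** * The fixed point algebra *)

Section SubalgebraMatrices.
Variables (R : rcfType) (B : starAlgType R) (S : subStarAlg B).

Definition mx_val m n (M : 'M[sub_alg S]_(m, n)) : 'M[B]_(m, n) :=
  map_mx (@sub_val R B S) M.

Lemma mx_val_inj m n : injective (@mx_val m n).
Proof.
move=> M N /matrixP MN; apply/matrixP => i j; apply: val_inj.
by have := MN i j; rewrite !mxE.
Qed.

Lemma mx_valM m n l (M : 'M[sub_alg S]_(m, n)) (N : 'M[sub_alg S]_(n, l)) :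
  mx_val (M *m N) = mx_val M *m mx_val N.
Proof.
apply/matrixP => i j; rewrite !mxE.
rewrite (big_morph (@sub_val R B S) (id1 := 0) (op1 := +%R)) //.
by apply: eq_bigr => k _; rewrite !mxE.
Qed.

Lemma mx_val_star m n (M : 'M[sub_alg S]_(m, n)) :
  mx_val (star_mx M) = star_mx (mx_val M).
Proof. by apply/matrixP => i j; rewrite !mxE. Qed.

Lemma mx_val_surj m n (M : 'M[B]_(m, n)) :
  (forall i j, sub_set S (M i j)) -> exists N, mx_val N = M.
Proof.
move=> MS; exists (\matrix_(i, j) to_sub (MS i j)).
by apply/matrixP => i j; rewrite !mxE.
Qed.

Lemma mx_val_projection m (M : 'M[sub_alg S]_m) :
  is_projection M -> is_projection (mx_val M).
Proof. by move=> [MM Ms]; split; rewrite -?mx_valM -?mx_val_star ?MM ?Ms. Qed.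

Lemma tracial_state_sub (tau : B -> R[i]) :
  tracial_state tau -> tracial_state (fun x : sub_alg S => tau (sub_val x)).
Proof.
move=> [tD tZ t0 t1 tC]; split=> *;
  [exact: tD|exact: tZ|exact: t0|exact: t1|exact: tC].
Qed.

End SubalgebraMatrices.

Theorem proposition4p15 (R : realType) (A : cstarAlg R) (G : topGroupType)
    (alpha : cstarAction G A) :
  simple_cstar A ->
  order_determined_by_traces A ->
  hausdorff_space G -> compact [set: G]%classic -> @second_countable G ->
  Rokhlin alpha ->
  order_determined_by_traces (sub_alg (fixed_alg alpha)).
Proof.
move=> _ ordA _ cG _ rok m n p q pp qq pq.
have fixE k l (M : 'M[sub_alg (fixed_alg alpha)]_(k, l)) g i j :
    alpha g (mx_val M i j) = mx_val M i j.
  by rewrite mxE; have /fixed_algP := sub_algP (M i j); exact.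
have pp' := mx_val_projection pp; have qq' := mx_val_projection qq.
have [tau tt|e [ee qe] [v [vp ve]]] := ordA _ _ _ _ pp' qq'.
  have := pq _ (tracial_state_sub (fixed_alg alpha) tt).
  by rewrite /trace_mx; under [X in _ -> X <= _]eq_bigr do rewrite mxE;
    under [X in _ -> _ <= X]eq_bigr do rewrite mxE.
(* With v p in place of v, the relation with q is purely algebraic: v p = v v^* v = e v, and q e =
   e. *)
have vp1 : star_mx (v *m mx_val p) *m (v *m mx_val p) = mx_val p.
  by rewrite star_mxM pp'.2 -mulmxA (mulmxA (star_mx v)) vp !pp'.1.
have qv : mx_val q *m (v *m mx_val p) = v *m mx_val p.
  by rewrite -vp (mulmxA v) ve mulmxA qe.
have [w0 [wfix wp qw]] := invariant_partial_isometry cG rok (fixE _ _ p) (fixE _ _ q)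
  pp' qq' vp1 qv.
have [w ww0] : exists w : 'M[sub_alg (fixed_alg alpha)]_(n, m), mx_val w = w0.
  by apply: mx_val_surj => i j; apply/fixed_algP => g; exact: wfix.
rewrite -ww0 in wp qw; have {}wp : star_mx w *m w = p.
  by apply: mx_val_inj; rewrite mx_valM mx_val_star.
have {}qw : q *m w = w by apply: mx_val_inj; rewrite mx_valM.
(* The factor [p] gives u p = u by construction, from which u u^* is idempotent. *)
pose u := w *m p.
have up : star_mx u *m u = p.
  by rewrite /u star_mxM pp.2 -mulmxA (mulmxA (star_mx w)) wp !pp.1.
have pu : u *m p = u by rewrite /u -mulmxA pp.1.
exists (u *m star_mx u); last by exists u.
split; last by rewrite mulmxA /u mulmxA qw.
split; last by rewrite star_mxM star_mxK.
by rewrite mulmxA -(mulmxA u) up pu.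
Qed.
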